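(* There exist an absolute constant $C>0$ and a bandit algorithm $\mathbb{A}$, which takes as input the time horizon $T$, a finite action set $\mathcal{A}\subseteq\mathbb{R}^d$ and the parameter $\rho$ (and has no knowledge of $\theta^\star$), such that for every integer $T\ge1$, every $\rho\in(0,1]$, every $d\ge1$, every $K\ge1$ and every action set $\mathcal{A}\subseteq\mathbb{R}^d$ with $|\mathcal{A}|=K$ and $\sup_{a\in\mathcal{A}}\|a\|_2\le1$ the following hold. (i) $\mathbb{A}$ is $\rho$-replicable for the stochastic $d$-dimensional linear bandit problem with action set $\mathcal{A}$ and horizon $T$. (ii) For every $\theta^\star\in\mathbb{R}^d$ with $\|\theta^\star\|_2\le1$ (and every admissible noise), the expected regret satisfies $$\mathbf{E}[R_T]\le C\cdot\frac{K^2}{\rho^2}\sqrt{dT\log(KT)}.$$ (iii) The running time of $\mathbb{A}$ is polynomial in $d$, $K$, $T$ and $1/\rho$.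
   Context: Stochastic linear bandits: each arm is a vector $a$ in a known action set $\mathcal{A}\subseteq\mathbb{R}^d$, and there is a parameter $\theta^\star\in\mathbb{R}^d$ unknown to the player, with $\|\theta^\star\|_2\le1$ and $\sup_{a\in\mathcal{A}}\|a\|_2\le1$. In round $t=1,\dots,T$ the player chooses $a_t\in\mathcal{A}$ and receives the reward $r_t=\langle\theta^\star,a_t\rangle+\eta_t$, where $\eta_t$ is a zero-mean 1-subgaussian random variable (i.e. $\mathbf{E}[\eta_t]=0$ and $\mathbf{E}[\exp(\lambda\eta_t)]\le\exp(\lambda^2/2)$ for all $\lambda\in\mathbb{R}$), independent of any other source of randomness. A bandit algorithm chooses $a_t=\mathbb{A}(a_1,r_1,\dots,a_{t-1},r_{t-1};\xi)$ as a function of the past arm-reward pairs and of internal randomness $\xi$ (independent of the noise). Expected regret: $\mathbf{E}[R_T]=T\sup_{a\in\mathcal{A}}\langle\theta^\star,a\rangle-\mathbf{E}\left[\sum_{t=1}^T\langle\theta^\star,a_t\rangle\right]$. Replicability: $\mathbb{A}$ is $\rho$-replicable if, for any $\theta^\star\in\mathbb{R}^d$ with $\|\theta^\star\|_2\le1$ and any noise variables $\eta_t$ that are zero-mean, 1-subgaussian and independent of any other source of randomness, and for two executions of $\mathbb{A}$ that share the same internal randomness $\xi$ but have independent reward (noise) realizations, $$\Pr\left[(a_1^{(1)},\dots,a_T^{(1)})=(a_1^{(2)},\dots,a_T^{(2)})\right]\ge1-\rho,$$ where $a_t^{(i)}$ is the action taken at round $t$ in execution $i$ and the probability is over $\xi$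 and the rewards of both executions. $\log$ is the natural logarithm. Running time counts elementary operations (arithmetic operations and comparisons on real numbers, and draws of internal random numbers). *)

(* Defs.v *)
From HB Require Import structures.
From mathcomp Require Import all_boot all_order all_algebra.
From mathcomp Require Import all_classical all_reals all_analysis.
(* mpoly is used through qualified names only: its notations clash with those
   of MathComp-Analysis. *)
From mathcomp Require mpoly.

Set Implicit Arguments.
Unset Strict Implicit.
Unset Printing Implicit Defensive.

Import Order.TTheory GRing.Theory Num.Theory.
Import numFieldNormedType.Exports.

Local Open Scope classical_set_scope.
Local Open Scope ring_scope.

Definition dotp (R : realType) (d : nat) (u v : 'rV[R]_d) : R :=
  \sum_(i < d) u 0 i * v 0 i.

(* MathComp-Analysis equips 'rV[R]_d with the sup norm; this is the
   Euclidean norm. *)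
Definition l2norm (R : realType) (d : nat) (u : 'rV[R]_d) : R :=
  Num.sqrt (dotp u u).

(* a_t = pol [:: (a_1, r_1); ...; (a_(t-1), r_(t-1))] xi, where the internal
   randomness xi is a sequence of numbers in [0, 1]. *)
Definition policy (R : realType) (d : nat) : Type :=
  seq ('rV[R]_d * R) -> (nat -> R) -> 'rV[R]_d.

(* Rounds are numbered from 0, and [rew t a] is the reward received if the arm
   [a] is played in round [t]. *)
Fixpoint history (R : realType) (d : nat) (pol : policy R d) (xi : nat -> R)
    (rew : nat -> 'rV[R]_d -> R) (t : nat) : seq ('rV[R]_d * R) :=
  if t is s.+1 then
    let h := history pol xi rew s in
    let a := pol h xi in
    rcons h (a, rew s a)
  else [::].

Definition action (R : realType) (d : nat) (pol : policy R d) (xi : nat -> R)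
    (rew : nat -> 'rV[R]_d -> R) (t : nat) : 'rV[R]_d :=
  pol (history pol xi rew t) xi.

Definition actions (R : realType) (d : nat) (pol : policy R d) (xi : nat -> R)
    (rew : nat -> 'rV[R]_d -> R) (T : nat) : seq 'rV[R]_d :=
  [seq action pol xi rew t | t <- iota 0 T].

Definition linear_reward (R : realType) (d : nat) (theta : 'rV[R]_d)
    (eta : nat -> R) : nat -> 'rV[R]_d -> R :=
  fun t a => dotp theta a + eta t.

(* The second clause says that the actions are random variables as soon as the
   internal random numbers and the rewards are. *)
Definition bandit_policy (R : realType) (d : nat) (A : seq 'rV[R]_d)
    (T : nat) (pol : policy R d) : Prop :=
  (forall h xi, pol h xi \in A) /\
  (forall (disp : measure_display) (Omega : measurableType disp)
     (xi : nat -> {mfun Omega >-> R})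
     (rew : nat -> 'rV[R]_d -> {mfun Omega >-> R})
     (t : nat) (a : 'rV[R]_d), (t < T)%N ->
     measurable [set w | action pol (fun j => xi j w)
                           (fun s b => rew s b w) t = a]).

Definition mutual_independence (disp : measure_display)
    (Omega : measurableType disp) (R : realType) (P : probability Omega R)
    (I : eqType) (X : I -> {RV P >-> R}) : Prop :=
  forall (J : seq I) (B : I -> set R), uniq J ->
    (forall i, measurable (B i)) ->
    P (\bigcap_(i in [set` J]) (X i @^-1` B i)) =
    (\prod_(i <- J) P (X i @^-1` B i))%E.

Definition uniform01 (disp : measure_display) (Omega : measurableType disp)
    (R : realType) (P : probability Omega R) (X : {RV P >-> R}) : Prop :=
  forall B : set R, measurable B ->
    P (X @^-1` B) = uniform_prob (@ltr01 R) B.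

Definition same_law (disp : measure_display) (Omega : measurableType disp)
    (R : realType) (P : probability Omega R) (X Y : {RV P >-> R}) : Prop :=
  forall B : set R, measurable B -> P (X @^-1` B) = P (Y @^-1` B).

Definition subgaussian1 (disp : measure_display) (Omega : measurableType disp)
    (R : realType) (P : probability Omega R) (X : {RV P >-> R}) : Prop :=
  ('E_P[X] = 0)%E /\
  forall lambda : R,
    ('E_P[fun w => expR (lambda * X w)] <= (expR (lambda ^+ 2 / 2))%:E)%E.

Definition one_run (disp : measure_display) (Omega : measurableType disp)
    (R : realType) (P : probability Omega R) (T : nat)
    (xi eta : nat -> {RV P >-> R}) : Prop :=
  [/\ forall j, uniform01 (xi j),
      forall t, (t < T)%N -> subgaussian1 (eta t) &
      mutual_independence
        (fun i : nat + 'I_T =>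
           match i with inl j => xi j | inr t => eta t end)].

(* Two executions sharing xi; eta1 and eta2 are two independent realizations
   of the same noise variables. *)
Definition two_runs (disp : measure_display) (Omega : measurableType disp)
    (R : realType) (P : probability Omega R) (T : nat)
    (xi eta1 eta2 : nat -> {RV P >-> R}) : Prop :=
  [/\ forall j, uniform01 (xi j),
      forall t, (t < T)%N -> subgaussian1 (eta1 t),
      forall t, (t < T)%N -> same_law (eta1 t) (eta2 t) &
      mutual_independence
        (fun i : nat + ('I_T + 'I_T) =>
           match i with
           | inl j => xi j
           | inr (inl t) => eta1 t
           | inr (inr t) => eta2 t
           end)].

Definition replicable (R : realType) (d : nat) (T : nat) (rho : R)
    (pol : policy R d) : Prop :=
  forall (disp : measure_display) (Omega : measurableType disp)
    (P : probability Omega R) (theta : 'rV[R]_d)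
    (xi eta1 eta2 : nat -> {RV P >-> R}),
  l2norm theta <= 1 -> two_runs T xi eta1 eta2 ->
  let acts (eta : nat -> {RV P >-> R}) (w : Omega) :=
    actions pol (fun j => xi j w)
      (linear_reward theta (fun t => eta t w)) T in
  ((1 - rho)%:E <= P [set w | acts eta1 w = acts eta2 w])%E.

Definition expected_regret (disp : measure_display)
    (Omega : measurableType disp) (R : realType) (P : probability Omega R)
    (d : nat) (T : nat) (A : seq 'rV[R]_d) (theta : 'rV[R]_d)
    (pol : policy R d) (xi eta : nat -> {RV P >-> R}) : \bar R :=
  ((T%:R * sup [set dotp theta a | a in [set` A]])%:E -
   'E_P[fun w => (\sum_(t < T)
           dotp theta (action pol (fun j => xi j w)
             (linear_reward theta (fun s => eta s w)) t))%R])%E.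

(* A real RAM with unit costs.  The memory consists of integer variables and of two-dimensional arrays of
   reals.  Only the reals have multiplication and division, the integers serve
   as counters and indices, and there is no conversion from reals to integers
   (no floor).  All constants occurring in a program are natural numbers. *)

Inductive iexpr : Type :=
| ICst of nat
| IVar of nat
| IAdd of iexpr & iexpr
| ISub of iexpr & iexpr.

Inductive rexpr : Type :=
| ROfInt of iexpr
| RCell of nat & iexpr & iexpr
| RAdd of rexpr & rexpr
| RSub of rexpr & rexpr
| RMul of rexpr & rexpr
| RDiv of rexpr & rexpr.

Inductive bexpr : Type :=
| BLeR of rexpr & rexpr
| BLeI of iexpr & iexpr
| BNot of bexpr
| BAnd of bexpr & bexpr.

(* [Draw x i j] stores the next internal random number in the cell (i, j) of
   the array x; [Pull k x i j] plays the k-th arm of the action set and stores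
   the reward in that cell. *)
Inductive cmd : Type :=
| Skip
| Seq of cmd & cmd
| SetI of nat & iexpr
| SetR of nat & iexpr & iexpr & rexpr
| If of bexpr & cmd & cmd
| While of bexpr & cmd
| Draw of nat & iexpr & iexpr
| Pull of iexpr & nat & iexpr & iexpr.

Fixpoint icost (e : iexpr) : nat :=
  match e with
  | ICst _ | IVar _ => 1
  | IAdd e1 e2 | ISub e1 e2 => (icost e1 + icost e2).+1
  end.

Fixpoint rcost (e : rexpr) : nat :=
  match e with
  | ROfInt i => (icost i).+1
  | RCell _ i j => (icost i + icost j).+1
  | RAdd e1 e2 | RSub e1 e2 | RMul e1 e2 | RDiv e1 e2 =>
      (rcost e1 + rcost e2).+1
  end.

Fixpoint bcost (b : bexpr) : nat :=
  match b with
  | BLeR e1 e2 => (rcost e1 + rcost e2).+1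
  | BLeI e1 e2 => (icost e1 + icost e2).+1
  | BNot b1 => (bcost b1).+1
  | BAnd b1 b2 => (bcost b1 + bcost b2).+1
  end.

Record state (R : realType) (d : nat) : Type := State {
  ints : nat -> nat;
  cells : nat -> nat -> nat -> R;
  draws : nat;                         (* number of draws so far *)
  played : seq ('rV[R]_d * R)          (* arms pulled, with their rewards *)
}.

Fixpoint ieval (m : nat -> nat) (e : iexpr) : nat :=
  match e with
  | ICst n => n
  | IVar x => m x
  | IAdd e1 e2 => (ieval m e1 + ieval m e2)%N
  | ISub e1 e2 => (ieval m e1 - ieval m e2)%N
  end.

(* Division by zero yields 0, as in MathComp. *)
Fixpoint reval (R : realType) (m : nat -> nat) (c : nat -> nat -> nat -> R)
    (e : rexpr) : R :=
  match e with
  | ROfInt i => (ieval m i)%:R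
  | RCell x i j => c x (ieval m i) (ieval m j)
  | RAdd e1 e2 => reval m c e1 + reval m c e2
  | RSub e1 e2 => reval m c e1 - reval m c e2
  | RMul e1 e2 => reval m c e1 * reval m c e2
  | RDiv e1 e2 => reval m c e1 / reval m c e2
  end.

Fixpoint beval (R : realType) (m : nat -> nat) (c : nat -> nat -> nat -> R)
    (b : bexpr) : bool :=
  match b with
  | BLeR e1 e2 => reval m c e1 <= reval m c e2
  | BLeI e1 e2 => (ieval m e1 <= ieval m e2)%N
  | BNot b1 => ~~ beval m c b1
  | BAnd b1 b2 => beval m c b1 && beval m c b2
  end.

Definition set_int (m : nat -> nat) (x v : nat) : nat -> nat :=
  fun y => if y == x then v else m y.

Definition set_cell (R : realType) (c : nat -> nat -> nat -> R)
    (x i j : nat) (v : R) : nat -> nat -> nat -> R :=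
  fun y k l => if [&& y == x, k == i & l == j] then v else c y k l.

(* [exec A xi rew c s s' n]: started in s, the program c halts in s' after n
   elementary operations.  Pulling a nonexistent arm is stuck. *)
Inductive exec (R : realType) (d : nat) (A : seq 'rV[R]_d) (xi : nat -> R)
    (rew : nat -> 'rV[R]_d -> R) :
    cmd -> state R d -> state R d -> nat -> Prop :=
| ExecSkip s : exec A xi rew Skip s s 1
| ExecSeq c1 c2 s1 s2 s3 n1 n2 :
    exec A xi rew c1 s1 s2 n1 -> exec A xi rew c2 s2 s3 n2 ->
    exec A xi rew (Seq c1 c2) s1 s3 (n1 + n2)
| ExecSetI x e m c k h :
    exec A xi rew (SetI x e) (State m c k h)
      (State (set_int m x (ieval m e)) c k h) (icost e).+1
| ExecSetR x i j e m c k h :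
    exec A xi rew (SetR x i j e) (State m c k h)
      (State m (set_cell c x (ieval m i) (ieval m j) (reval m c e)) k h)
      (icost i + icost j + rcost e).+1
| ExecIf b c1 c2 s s' n :
    exec A xi rew (if beval (ints s) (cells s) b then c1 else c2) s s' n ->
    exec A xi rew (If b c1 c2) s s' (bcost b + n).+1
| ExecWhileFalse b c s :
    ~~ beval (ints s) (cells s) b ->
    exec A xi rew (While b c) s s (bcost b).+1
| ExecWhileTrue b c s1 s2 s3 n1 n2 :
    beval (ints s1) (cells s1) b ->
    exec A xi rew c s1 s2 n1 -> exec A xi rew (While b c) s2 s3 n2 ->
    exec A xi rew (While b c) s1 s3 (bcost b + n1 + n2).+1
| ExecDraw x i j m c k h :
    exec A xi rew (Draw x i j) (State m c k h)
      (State m (set_cell c x (ieval m i) (ieval m j) (xi k)) k.+1 h)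
      (icost i + icost j).+1
| ExecPull e x i j m c k h :
    (ieval m e < size A)%N ->
    let a := nth 0 A (ieval m e) in
    let r := rew (size h) a in
    exec A xi rew (Pull e x i j) (State m c k h)
      (State m (set_cell c x (ieval m i) (ieval m j) r) k (rcons h (a, r)))
      (icost e + icost i + icost j).+1.

(* Inputs: d, K, T in the integer variables 0, 1, 2; rho in the cell (0, 0) of
   the array 0; the j-th coordinate of the k-th arm in the cell (k, j) of the
   array 1.  The rest of the memory is 0. *)
Definition init_state (R : realType) (d : nat) (T : nat) (A : seq 'rV[R]_d)
    (rho : R) : state R d :=
  State (fun x => nth 0%N [:: d; size A; T] x)
    (fun x k j =>
       match x with
       | 0 => if (k == 0%N) && (j == 0%N) then rho else 0
       | 1 => if insub j is Some j' then (nth 0 A k) 0 j' else 0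
       | _ => 0
       end)
    0 [::].

(* The program plays the policy pol for T rounds, whatever the internal random
   numbers and the rewards are, within the given number of operations. *)
Definition implements_within (R : realType) (d : nat) (prog : cmd) (T : nat)
    (A : seq 'rV[R]_d) (rho : R) (pol : policy R d) (bound : R) : Prop :=
  forall (xi : nat -> R) (rew : nat -> 'rV[R]_d -> R),
    (forall j, 0 <= xi j <= 1) ->
    exists (s : state R d) (n : nat),
      [/\ exec A xi rew prog (init_state T A rho) s n,
          played s = history pol xi rew T &
          n%:R <= bound].

(* Main.v *)
Require Import Defs.
From HB Require Import structures.
From mathcomp Require Import all_boot all_order all_algebra.
From mathcomp Require Import all_classical all_reals all_analysis.
From mathcomp Require Import measurable_realfun measurable_fun_approximation.
From mathcomp Require Import simple_functions.
From mathcomp Require Import zify ring lra.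
From mathcomp Require mpoly.
Import (canonicals) mpoly.
Import Order.TTheory GRing.Theory Num.Theory.
Import numFieldNormedType.Exports.
Local Open Scope classical_set_scope.
Local Open Scope ring_scope.
Set Implicit Arguments.
Unset Strict Implicit.
Unset Printing Implicit Defensive.

(** Since [d >= 1], the linear structure can be ignored: it suffices to play a
    replicable successive elimination on [K] arms.  Rounds are cut into slots
    fixed in advance; slot [s] belongs to batch [b = s / K] and to arm [s mod K],
    and has length [n0 * 16 ^ b].  If the arm of the slot is active it is played
    during the slot, otherwise the last active arm is.  An arm stays active as
    long as its estimate in the previous batch is within [4 (1 + U) / 4 ^ b] of
    the best one, where [U] is a single uniform random number.

    As the slots do not depend on the observations, the average reward that the
    arm of a slot yields there is a mean of independent subgaussian variables,
    and by Chernoff bounds all these averages are accurate up to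
    [1 / (8 M 4 ^ b)], with [M = ceil (K / rho)], outside an event of probability
    [1 / (8 M ^ 2 T)].  Then in batch [b] only arms with gap [O(4 ^ - b)] are
    played, while [16 ^ b] is at least of order [t / (K n0)] at round [t]; summing
    over [t] bounds the regret by [O(sqrt (K n0 T))].

    For two runs sharing [U] with accurate averages, the decisions can only differ
    if [1 + U] is within [1 / (4 M)] of [gap * 4 ^ b] for some arm and some batch.
    As [1 + U] lies in [[1, 2]], for each arm at most one [b] matters, so that this
    has probability at most [K / (2 M) <= rho / 2]. *)

(** * Slots and estimates *)

Section Slots.
Local Open Scope nat_scope.
Variables (K n0 : nat).
Hypotheses (K_gt0 : (0 < K)%N) (n0_gt0 : (0 < n0)%N).

Definition slot_len (s : nat) : nat := (n0 * 16 ^ (s %/ K))%N.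

Definition slot_start (s : nat) : nat := (\sum_(i < s) slot_len i)%N.

Fixpoint slot (t : nat) : nat :=
  if t is t'.+1 then
    if (slot_start (slot t').+1 <= t'.+1)%N then (slot t').+1 else slot t'
  else 0.

Lemma slot_len_gt0 s : (0 < slot_len s)%N.
Proof. by rewrite muln_gt0 n0_gt0 expn_gt0. Qed.

Lemma slot_startS s : slot_start s.+1 = (slot_start s + slot_len s)%N.
Proof. by rewrite /slot_start big_ord_recr. Qed.

Lemma slot_start_ltS s : (slot_start s < slot_start s.+1)%N.
Proof. by rewrite slot_startS -addn1 leq_add2l slot_len_gt0. Qed.

Lemma leq_slot_start s s' : (s <= s')%N -> (slot_start s <= slot_start s')%N.
Proof.
elim: s' => [|s' IH]; first by rewrite leqn0 => /eqP->.
rewrite leq_eqVlt => /predU1P[->//|]; rewrite ltnS => /IH /leq_trans; apply.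
exact/ltnW/slot_start_ltS.
Qed.

Lemma leq_slot_start_id s : (s <= slot_start s)%N.
Proof. by elim: s => [//|s IH]; exact: leq_ltn_trans (slot_start_ltS s). Qed.

Lemma slot_bounds t : (slot_start (slot t) <= t < slot_start (slot t).+1)%N.
Proof.
elim: t => [|t /andP[le_t lt_t]] /=.
  by rewrite /slot_start big_ord0 big_ord1 slot_len_gt0.
case: ifPn => [->|]; last by rewrite -ltnNge => ->; rewrite (leq_trans le_t).
by rewrite (leq_ltn_trans _ (slot_start_ltS _)).
Qed.

Lemma divn_batch b k : k < K -> (b * K + k) %/ K = b.
Proof. by case: K => // K' ltk; rewrite divnMDl// divn_small// addn0. Qed.

Lemma modn_batch b k : k < K -> (b * K + k) %% K = k.
Proof. by move=> ltk; rewrite modnMDl modn_small. Qed.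

Lemma divn_modnS s : (s %% K = K.-1 /\ s.+1 %/ K = (s %/ K).+1 /\ s.+1 %% K = 0%N)
  \/ ((s %% K).+1 < K /\ s.+1 %/ K = s %/ K /\ s.+1 %% K = (s %% K).+1)%N.
Proof.
have Es := divn_eq s K; have ltK := ltn_pmod s K_gt0.
have [lt|ge] := ltnP (s %% K).+1 K.
  right; split=> //.
  have -> : s.+1 = (s %/ K * K + (s %% K).+1)%N by rewrite addnS -Es.
  by rewrite divn_batch// modn_batch.
have E : (s %% K).+1 = K by apply/eqP; rewrite eqn_leq ge ltK.
left; split; first by rewrite -[in RHS]E.
have -> : s.+1 = ((s %/ K).+1 * K)%N by rewrite mulSn -[X in (X + _)%N]E addSn addnC -Es.
by rewrite mulnK// modnMl.
Qed.

(** A geometric sum, since a complete batch [b] takes [K * n0 * 16 ^ b] rounds. Multiplying by 15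
    and moving the negative term to the left avoids division and subtraction. *)
Lemma slot_start_closed s :
  (15 * slot_start s + K * n0 = (K + 15 * (s %% K)) * n0 * 16 ^ (s %/ K))%N.
Proof.
elim: s => [|s IH]; first by rewrite /slot_start big_ord0 div0n mod0n; lia.
rewrite slot_startS /slot_len mulnDr addnAC IH.
have [[E [-> ->]]|[_ [-> ->]]] := divn_modnS s; last by lia.
by rewrite E expnS; nia.
Qed.

(** By geometric growth, all batches up to the current one take at most [16 / 15] of the full length
    of the current one. This makes [4 ^ b] at least of order [sqrt (t / (K * n0))]. *)
Lemma leq_slot_time t : (t.+1 <= 2 * (K * n0 * 16 ^ (slot t %/ K)))%N.
Proof.
have /andP[_ lt_t] := slot_bounds t; apply: leq_trans lt_t _.
rewrite slot_startS /slot_len; have := slot_start_closed (slot t).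
have := ltn_pmod (slot t) K_gt0.
move: (slot t %% K)%N (16 ^ _)%N (slot_start _) => k N S ltk E.
have := leq_mul (leq_mul ltk (leqnn n0)) (leqnn N); rewrite -[in X in X -> _]addn1; nia.
Qed.
End Slots.

Fixpoint running_max (R : realType) (e : nat -> R) (n : nat) : R :=
  if n is n'.+1 then Num.max (running_max e n') (e n') else - 10.

(** * Elimination as a function of the slot averages *)

Section Estimates.
Variables (R : realType) (K : nat) (u : R).

Definition max_est (e : nat -> R) : R := running_max e K.

(** Batch [b] tests estimates made in batch [b - 1]; the factor 4 puts the threshold at their scale,
    namely [u / 4 ^ (b - 1)]. *)
Definition threshold (b : nat) : R := 4 * u / 4 ^+ b.

(* [- 10] marks an eliminated arm: means lie in [-1, 1] and thresholds are at
   most 2 after the first batch, so such an arm is never active again. *)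
Fixpoint est (X : nat -> R) (b : nat) : nat -> R :=
  if b is b'.+1 then
    let e := est X b' in
    fun k => if max_est e - e k <= threshold b' then X (b' * K + k)%N else - 10
  else fun _ => 0.

Definition active (X : nat -> R) (s : nat) : bool :=
  max_est (est X (s %/ K)) - est X (s %/ K) (s %% K) <= threshold (s %/ K).

(** For [0 <= u] the default 0 is never reached, as slot 0 is active by [active0]. *)
Fixpoint lead (X : nat -> R) (s : nat) : nat :=
  if active X s then (s %% K)%N else if s is s'.+1 then lead X s' else 0%N.

Hypothesis K_gt0 : (0 < K)%N.

Lemma estS X b k : (k < K)%N ->
  est X b.+1 k = if active X (b * K + k) then X (b * K + k)%N else - 10.
Proof.
by move=> ltk; rewrite /active divn_batch// modn_batch.
Qed.

Lemma eq_running_max (e e' : nat -> R) n :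
  (forall k, (k < n)%N -> e k = e' k) -> running_max e n = running_max e' n.
Proof.
by elim: n => //= n IH eqe; rewrite eqe// IH// => k /ltnW; exact: eqe.
Qed.

Lemma eq_max_est e e' : (forall k, (k < K)%N -> e k = e' k) ->
  max_est e = max_est e'.
Proof. exact: eq_running_max. Qed.

Lemma ge_max_est e k : (k < K)%N -> e k <= max_est e.
Proof.
rewrite /max_est; elim: K => // n IH; rewrite ltnS leq_eqVlt /= le_max.
by move=> /predU1P[->|/IH->]; rewrite ?lexx ?orbT.
Qed.

Lemma running_max_le (e : nat -> R) x n : - 10 <= x ->
  (forall k, (k < n)%N -> e k <= x) -> running_max e n <= x.
Proof.
move=> x10; elim: n => //= n IH ex.
by rewrite ge_max ex// IH// => k /ltnW; exact: ex.
Qed.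

Lemma max_est_le e x : - 10 <= x -> (forall k, (k < K)%N -> e k <= x) ->
  max_est e <= x.
Proof. exact: running_max_le. Qed.

(** The average of an inactive slot is replaced by [- 10] and never read. This is what allows
    averages of arms that were not played in the analysis. *)
Lemma eq_est X X' b : (forall s, (s < b * K)%N -> active X s -> X s = X' s) ->
  forall k, (k < K)%N -> est X b k = est X' b k.
Proof.
elim: b => [//|b IH] eqX k ltk.
have {}IH : forall k, (k < K)%N -> est X b k = est X' b k.
  by apply: IH => s lts; apply: eqX; rewrite mulSn ltn_addl.
have eq_act : active X (b * K + k) = active X' (b * K + k).
  rewrite /active divn_batch// modn_batch//.
  by rewrite (eq_max_est IH) IH.
by rewrite !estS// -eq_act; case: ifP => // /eqX->//; rewrite mulSn addnC ltn_add2r.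
Qed.

Lemma eq_active X X' s :
  (forall s', (s' < s %/ K * K)%N -> active X s' -> X s' = X' s') ->
  active X s = active X' s.
Proof.
move=> /eq_est eqe; rewrite /active (eq_max_est eqe) eqe ?ltn_pmod//.
Qed.

Lemma leq_divnM s : (s %/ K * K <= s)%N.
Proof. exact: leq_trunc_div. Qed.

Lemma eq_lead X X' s :
  (forall s', (s' < s)%N -> active X s' -> X s' = X' s') -> lead X s = lead X' s.
Proof.
elim: s => [|s IH] eqX.
  by rewrite /= (@eq_active X X')// => s'; rewrite div0n mul0n.
rewrite /= (@eq_active X X') ?IH// => s' lts; apply: eqX.
  by rewrite ltnS ltnW.
exact: leq_trans lts (leq_divnM _).
Qed.

Lemma lead_lt X s : (lead X s < K)%N.
Proof. by elim: s => [|s IH] /=; case: ifP; rewrite ?ltn_pmod. Qed.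

Lemma lead_active X s : active X s -> lead X s = (s %% K)%N.
Proof. by case: s => [|s] /= ->. Qed.

Lemma lead_last X s s0 : (s0 <= s)%N -> active X s0 ->
  exists s', [/\ (s0 <= s' <= s)%N, active X s' & lead X s = (s' %% K)%N].
Proof.
elim: s => [|s IH] les act0.
  by move: les act0; rewrite leqn0 => /eqP-> act0; exists 0%N; rewrite lead_active.
have [act|nact] := boolP (active X s.+1).
  by exists s.+1; rewrite les leqnn lead_active.
move: les; rewrite leq_eqVlt => /predU1P[E|]; first by rewrite -E act0 in nact.
rewrite ltnS => /IH/(_ act0)[s' [/andP[l1 l2] act' E]]; exists s'.
by rewrite l1 (leq_trans l2)//= (negPf nact).
Qed.

Lemma active0 X s : 0 <= u -> (s %/ K)%N = 0%N -> active X s.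
Proof.
move=> u0 E; rewrite /active E /threshold expr0 divr1 /est subr0.
apply: max_est_le => [|k _]; last by rewrite mulr_ge0.
by rewrite (le_trans _ (mulr_ge0 _ u0))// oppr_le0.
Qed.

(** * Elimination when the averages are accurate *)

Section Accuracy.
Variables (mu : nat -> R) (best : nat) (c : R).
Hypotheses (u_ge1 : 1 <= u) (u_le2 : u <= 2) (c_gt0 : 0 < c) (c_le : c <= 1 / 8).
Hypotheses (mu_le1 : forall k, (k < K)%N -> `|mu k| <= 1).
Hypotheses (best_lt : (best < K)%N)
  (best_max : forall k, (k < K)%N -> mu k <= mu best).

Local Notation gap k := (mu best - mu k).

Let gap_ge0 k : (k < K)%N -> 0 <= gap k.
Proof. by move=> /best_max; rewrite subr_ge0. Qed.

Let gap_le2 k : (k < K)%N -> gap k <= 2.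
Proof.
by move=> /mu_le1; have := mu_le1 best_lt; rewrite !ler_norml; lra.
Qed.

Let pow4 b : 0 < ((4 : R) ^+ b)^-1 <= 1.
Proof. by rewrite invr_gt0 exprn_gt0//= invf_le1 ?exprn_gt0// exprn_ege1// ler1n. Qed.

Let c_pow4 b : c / 4 ^+ b <= 1 / 8 / 4 ^+ b.
Proof. by case/andP: (pow4 b) => w0 _; rewrite ler_pM2r. Qed.

Let u_pow4 b : 1 / 4 ^+ b <= u / 4 ^+ b <= 2 / 4 ^+ b.
Proof. by case/andP: (pow4 b) => w0 _; rewrite !ler_pM2r// u_ge1. Qed.

Let thresholdS b : threshold b.+1 = u * (4 ^+ b)^-1.
Proof. by rewrite /threshold exprS; field; rewrite expf_neq0. Qed.

(** Only the batches before [B] count: the estimates tested in batch [B] read nothing later, and the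
    horizon may cut batch [B] short. *)
Definition accurate (X : nat -> R) (B : nat) : Prop :=
  forall s, (s < B * K)%N -> `|X s - mu (s %% K)| <= c / 4 ^+ (s %/ K).

(** The invariant of the elimination; [est] files the estimates made in batch [b] under [b.+1]. The
    last clause keeps the best arm from being eliminated. *)
Definition batch_ok (X : nat -> R) (b : nat) : Prop :=
  (forall k, (k < K)%N ->
     est X b.+1 k = - 10 \/ `|est X b.+1 k - mu k| <= c / 4 ^+ b) /\
  `|est X b.+1 best - mu best| <= c / 4 ^+ b.

Lemma max_est_ok X b : batch_ok X b ->
  `|max_est (est X b.+1) - mu best| <= c / 4 ^+ b.
Proof.
move=> [ok okb]; have := mu_le1 best_lt => m1.
have /andP[w0 w1] := pow4 b; have cw : 0 <= c / 4 ^+ b by rewrite mulr_ge0// ltW.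
rewrite ler_norml; apply/andP; split.
  have := @ge_max_est (est X b.+1) _ best_lt.
  by move: okb; rewrite ler_norml => /andP[]; lra.
rewrite lerBlDr; apply: max_est_le => [|k ltk].
  by move: m1; rewrite ler_norml => /andP[]; lra.
have [->|] := ok _ ltk; first by move: m1; rewrite ler_norml => /andP[]; lra.
by rewrite ler_norml; have := best_max ltk => ? /andP[]; lra.
Qed.

(** Elimination is final: the maximal estimate is at least [- 1 - 1 / 8], more than 8 above the
    mark, while the threshold is at most 2. *)
Lemma eliminated_inactive X b k : batch_ok X b -> est X b.+1 k = - 10 ->
  max_est (est X b.+1) - est X b.+1 k <= threshold b.+1 = false.
Proof.
move=> /max_est_ok ok ->; apply/negbTE; rewrite -ltNge thresholdS.
have /andP[w0 w1] := pow4 b; move: ok; rewrite ler_norml => /andP[+ _].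
have := mu_le1 best_lt; rewrite ler_norml => /andP[+ _].
move: w0 w1; set w := (4 ^+ b)^-1 => w0 w1 m1 ok.
have := c_pow4 b; rewrite -/w.
have /andP[] := u_pow4 b; rewrite -/w.
by lra.
Qed.

Lemma gap_est X b k : batch_ok X b -> (k < K)%N -> est X b.+1 k <> - 10 ->
  `|max_est (est X b.+1) - est X b.+1 k - gap k| <= 2 * c / 4 ^+ b.
Proof.
move=> ok ltk ne; have [/(_ k ltk)[//|okk] _] := ok.
have := max_est_ok ok; move: okk; rewrite -mulrA.
by rewrite !ler_norml => /andP[? ?] /andP[? ?]; apply/andP; split; lra.
Qed.

(** Induction on the batch. The best arm survives since its estimated gap is at most
    [2 * c / 4 ^ b], a quarter of [1 / 4 ^ b], while the threshold is at least [1 / 4 ^ b]. *)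
Lemma accurate_batch_ok X B b : accurate X B -> (b < B)%N -> batch_ok X b.
Proof.
move=> acc; elim: b => [|b IH] ltb.
  have accb k : (k < K)%N -> `|est X 1 k - mu k| <= c / 4 ^+ 0.
    move=> ltk; rewrite estS// mul0n add0n active0 ?divn_small//; last first.
      exact: le_trans u_ge1.
    have := acc k; rewrite divn_small// modn_small//; apply.
    by rewrite (leq_trans ltk)// leq_pmull.
  by split=> [k /accb|]; [right|exact: accb].
have ok : batch_ok X b by apply: IH; exact: ltnW.
have accb k : (k < K)%N -> `|X (b.+1 * K + k)%N - mu k| <= c / 4 ^+ b.+1.
  move=> ltk; have := acc (b.+1 * K + k)%N.
  rewrite divn_batch// modn_batch//; apply.
  by apply: leq_trans (leq_mul ltb (leqnn K)); rewrite [in leqRHS]mulSn addnC ltn_add2r.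
split=> [k ltk|].
  by rewrite estS//; case: ifP => _; [right; exact: accb|left].
rewrite estS// ifT ?accb// /active divn_batch// modn_batch//.
have := max_est_ok ok; case: ok => _; rewrite thresholdS.
have /andP[] := pow4 b; set w := (4 ^+ b)^-1 => w0 w1.
rewrite !ler_norml => /andP[? ?] /andP[? ?].
have := c_pow4 b; rewrite -/w.
have /andP[] := u_pow4 b; rewrite -/w.
by lra.
Qed.

(** At the scale [4 ^ - (b - 1)], an active arm has estimated gap at most 2 with error at most
    [1 / 4]; so the true gap is at most [9 / 4] at that scale. In batch 0, gaps are at most 2
    anyway. *)
Lemma active_gap X B s : accurate X B -> (s %/ K <= B)%N -> active X s ->
  gap (s %% K) <= 9 / 4 ^+ (s %/ K).
Proof.
have ltk := ltn_pmod s K_gt0; set k := (s %% K)%N in ltk *.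
case Eb: (s %/ K)%N => [|b] acc leb.
  by move=> _; rewrite expr0 divr1; have := gap_le2 ltk; lra.
have ok := accurate_batch_ok acc leb; rewrite /active Eb -/k => act.
have ne : est X b.+1 k <> - 10.
  by move=> /(eliminated_inactive ok); rewrite act.
have := gap_est ok ltk ne; rewrite ler_norml => /andP[+ _]; move: act.
have -> : 9 / 4 ^+ b.+1 = 9 / 4 * (4 ^+ b)^-1 :> R by rewrite exprS; field; rewrite expf_neq0.
rewrite thresholdS -mulrA; have /andP[] := pow4 b; set w := (4 ^+ b)^-1 => w0 w1.
have := c_pow4 b; rewrite -/w.
have /andP[] := u_pow4 b; rewrite -/w.
by lra.
Qed.

Lemma active_best X B s : accurate X B -> (s %/ K <= B)%N -> (s %% K)%N = best ->
  active X s.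
Proof.
move=> acc leb E.
case Eb: (s %/ K)%N leb => [|b] leb; first by apply: active0 => //; exact: le_trans u_ge1.
have ok := accurate_batch_ok acc leb.
rewrite /active Eb E; have := max_est_ok ok; case: ok => _; rewrite thresholdS.
have /andP[] := pow4 b; set w := (4 ^+ b)^-1 => w0 w1.
rewrite !ler_norml => /andP[? ?] /andP[? ?].
have := c_pow4 b; rewrite -/w.
have /andP[] := u_pow4 b; rewrite -/w.
by lra.
Qed.

(** The best arm is active in the previous batch, so the last active slot lies in that batch or in
    the current one. Using the bound of the previous batch turns 9 into 36. *)
Lemma lead_gap X s : accurate X (s %/ K) ->
  gap (lead X s) <= 36 / 4 ^+ (s %/ K).
Proof.
move=> acc; case Eb: (s %/ K)%N => [|b].
  by rewrite expr0 divr1; have := gap_le2 (lead_lt X s); lra.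
have act : active X (b * K + best).
  apply: (active_best acc); last by rewrite modnMDl modn_small.
  by rewrite divn_batch// Eb.
have les : (b * K + best <= s)%N.
  by rewrite (leq_trans _ (leq_divnM s))// Eb mulSn addnC leq_add2r ltnW.
have [s' [/andP[l1 l2] act' ->]] := lead_last les act.
have : (b <= s' %/ K)%N by rewrite (leq_trans _ (leq_div2r K l1))// divn_batch.
move=> leb; apply: (le_trans (active_gap acc (leq_div2r K l2) act')).
have -> : 36 / 4 ^+ b.+1 = 9 / 4 ^+ b :> R by rewrite exprS; field; rewrite expf_neq0.
by rewrite ler_pM2l// lef_pV2 ?posrE ?exprn_gt0// ler_eXn2l// ltr1n.
Qed.

(** In both runs the estimated gap of a surviving arm is within [2 * c / 4 ^ b] of the true gap,
    whereas the threshold [u / 4 ^ b] is farther away; so both tests agree. The surviving arms are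
    the same by induction on the batch. *)
Lemma eq_lead_separated X X' B :
  (forall b k, (k < K)%N -> 2 * c < `|u - gap k * 4 ^+ b|) ->
  accurate X B -> accurate X' B ->
  forall s, (s %/ K <= B)%N -> lead X s = lead X' s.
Proof.
move=> sep acc acc'.
have eq_act b : (b <= B)%N -> forall k, (k < K)%N ->
    active X (b * K + k) = active X' (b * K + k).
  elim: b => [|b IH] leb k ltk.
    by rewrite !active0 ?(le_trans _ u_ge1)// mul0n add0n divn_small.
  have ok := accurate_batch_ok acc leb; have ok' := accurate_batch_ok acc' leb.
  have actE Y : active Y (b.+1 * K + k) =
      (max_est (est Y b.+1) - est Y b.+1 k <= threshold b.+1).
    by rewrite /active divn_batch// modn_batch.
  have estE Y := estS Y b ltk.
  rewrite !actE; have := IH (ltnW leb) k ltk; case Ea: (active X _) => Ea'; last first.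
    by rewrite !eliminated_inactive// estE ?Ea// -Ea'.
  (* An accurate average is at least [- 1 - 1 / 8], so it cannot be mistaken for the mark. *)
  have accE Y : accurate Y B -> active Y (b * K + k) ->
      est Y b.+1 k <> -10.
    move=> accY actY; rewrite estE actY; have := accY (b * K + k)%N.
    rewrite divn_batch// modn_batch// => accYb E.
    have : (b * K + k < B * K)%N.
      by apply: leq_trans (leq_mul leb (leqnn K)); rewrite [in leqRHS]mulSn addnC ltn_add2r.
    move=> /accYb; rewrite E ler_norml => /andP[+ _].
    have := mu_le1 ltk; rewrite ler_norml => /andP[+ _].
    by have /andP[w0 w1] := pow4 b; have := c_pow4 b; lra.
  have g := gap_est ok ltk (accE _ acc Ea).
  have g' := gap_est ok' ltk (accE _ acc' (esym Ea')).
  rewrite thresholdS; move: g g'; have := sep b k ltk.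
  have -> : gap k * 4 ^+ b = gap k / (4 ^+ b)^-1 by rewrite invrK.
  have /andP[] := pow4 b; set w := (4 ^+ b)^-1 => w0 w1.
  set D := max_est _ - _; set D' := max_est _ - _ => sp.
  have : 2 * c * w < `|u * w - gap k|.
    have -> : u * w - gap k = (u - gap k / w) * w by field; rewrite gt_eqF.
    by rewrite normrM (gtr0_norm w0) ltr_pM2r.
  rewrite !ler_norml lter_normr => /orP[|] ? /andP[? ?] /andP[? ?].
    by have -> : D <= u * w; [lra|have -> : D' <= u * w by lra].
  have -> : D <= u * w = false by apply/negbTE; rewrite -ltNge; lra.
  by apply/esym/negbTE; rewrite -ltNge; lra.
have act s : (s %/ K <= B)%N -> active X s = active X' s.
  by move=> /eq_act/(_ _ (ltn_pmod s K_gt0)); rewrite -divn_eq.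
elim=> [|s IH] les /=; first by rewrite act.
by rewrite act// IH// (leq_trans _ les)// leq_div2r.
Qed.

(** As [2 * c <= 1 / 4], a product [gap k * 4 ^ b] close to some [v] in [[1, 2]] lies in
    [[3 / 4, 9 / 4]]. The endpoints have ratio 3, less than 4, so at most one [b] qualifies, and [x]
    is its product. *)
Lemma separation_center k : (k < K)%N ->
  exists x : R, forall v b, 1 <= v <= 2 ->
    `|v - gap k * 4 ^+ b| <= 2 * c -> `|v - x| <= 2 * c.
Proof.
move=> ltk; have g0 := gap_ge0 ltk.
have [[v0 [b0 [v012 vb0]]]|none] := pselect (exists v b, 1 <= v <= 2 /\
    `|v - gap k * 4 ^+ b| <= 2 * c); last first.
  by exists 0 => v b v12 vb; exfalso; apply: none; exists v, b.
have lt4 v v' b b' : 1 <= v <= 2 -> 1 <= v' <= 2 ->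
    `|v - gap k * 4 ^+ b| <= 2 * c -> `|v' - gap k * 4 ^+ b'| <= 2 * c -> (b <= b')%N.
  move=> /andP[_ v2] /andP[v1 _]; rewrite !ler_norml => /andP[h _] /andP[_ h'].
  rewrite leqNgt; apply/negP => ltb.
  have : (4:R) * 4 ^+ b' <= 4 ^+ b by rewrite -exprS ler_eXn2l// ltr1n.
  move=> /(ler_wpM2l g0); rewrite mulrCA; move: h h'.
  by move: (gap k * _) (gap k * _) c_le => x y; lra.
exists (gap k * 4 ^+ b0) => v b v12 vb.
suff -> : b0 = b by [].
by apply/eqP; rewrite eqn_leq (lt4 v0 v)// (lt4 v v0).
Qed.

End Accuracy.
End Estimates.

(** * The policy *)

Lemma slot_unique (K n0 : nat) : (0 < n0)%N -> forall s t,
  (slot_start K n0 s <= t < slot_start K n0 s.+1)%N -> slot K n0 t = s.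
Proof.
move=> n0_gt0 s t /andP[le_t lt_t]; have /andP[le_s lt_s] := slot_bounds K n0_gt0 t.
apply/eqP; rewrite eqn_leq -ltnS -[X in _ && X]ltnS; apply/andP; split.
  rewrite ltnNge; apply/negP => /(leq_slot_start K n0_gt0) H.
  by have := leq_ltn_trans (leq_trans H le_s) lt_t; rewrite ltnn.
rewrite ltnNge; apply/negP => /(leq_slot_start K n0_gt0) H.
by have := leq_ltn_trans (leq_trans H le_t) lt_s; rewrite ltnn.
Qed.

Section SlotPolicy.
Variables (R : realType) (d : nat).

(** A uniform random number may leave [[0, 1]] on a null set; clipping keeps [u] in [[1, 2]] for
    every outcome. *)
Definition clip (x : R) : R := Num.min 1 (Num.max 0 x).

Definition slot_avg (K n0 : nat) (r : nat -> R) (s : nat) : R :=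
  (\sum_(i < slot_len K n0 s) r (slot_start K n0 s + i)%N)
    / (slot_len K n0 s)%:R.

(** Future rewards read as 0, harmlessly: [lead] at the current slot depends only on averages of
    earlier, complete slots. *)
Definition slot_policy (A : seq 'rV[R]_d) (n0 : nat) : policy R d :=
  fun h xi =>
    nth 0 A (lead (size A) (1 + clip (xi 0%N))
      (slot_avg (size A) n0 (fun i => (nth (0, 0) h i).2))
      (slot (size A) n0 (size h))).

(* Counterfactual: the arm of slot [s] need not have been played in that slot. *)
Definition arm_avg (A : seq 'rV[R]_d) (n0 : nat)
    (rew : nat -> 'rV[R]_d -> R) (s : nat) : R :=
  slot_avg (size A) n0 (fun i => rew i (nth 0 A (s %% size A))) s.

Lemma clip_id x : 0 <= x <= 1 -> clip x = x.
Proof. by move=> /andP[x0 x1]; rewrite /clip max_r// min_r. Qed.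

Lemma clip_itv x : 1 <= 1 + clip x <= 2.
Proof.
have : 0 <= clip x <= 1 by rewrite /clip le_min ge_min le_max ler01 !lexx.
by move=> /andP[]; lra.
Qed.

Lemma size_history pol xi (rew : nat -> 'rV[R]_d -> R) t :
  size (history pol xi rew t) = t.
Proof. by elim: t => //= t IH; rewrite size_rcons IH. Qed.

Lemma nth_history pol xi (rew : nat -> 'rV[R]_d -> R) t i : (i < t)%N ->
  nth (0, 0) (history pol xi rew t) i
  = (action pol xi rew i, rew i (action pol xi rew i)).
Proof.
elim: t => //= t IH; rewrite ltnS leq_eqVlt nth_rcons size_history.
by case: ltngtP => //= [lt _|-> _]; [exact: IH|].
Qed.

Section Play.
Variables (A : seq 'rV[R]_d) (n0 : nat).
Hypotheses (A_gt0 : (0 < size A)%N) (n0_gt0 : (0 < n0)%N).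
Let K := size A.

Lemma slot_policy_in h xi : slot_policy A n0 h xi \in A.
Proof. exact/mem_nth/lead_lt. Qed.

(** In an active slot the arm of the slot is played throughout, so the observed and the
    counterfactual average coincide. On inactive slots they may differ, but there [lead] ignores
    them. *)
Lemma action_slot_policy xi rew t :
  action (slot_policy A n0) xi rew t
  = nth 0 A (lead K (1 + clip (xi 0%N)) (arm_avg A n0 rew) (slot K n0 t)).
Proof.
elim/ltn_ind: t => t IH; rewrite /action /slot_policy size_history -/K.
set u := 1 + _; set X := slot_avg K n0 _; congr nth.
suff eqX s : (s < slot K n0 t)%N -> active K u X s -> X s = arm_avg A n0 rew s.
  exact: eq_lead.
(* Activity is given for the observed averages; this inner induction transfers it to the
   counterfactual ones, which determine the arm played according to [IH]. *)
elim/ltn_ind: s => s IHs lts act.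
have act' : active K u (arm_avg A n0 rew) s.
  rewrite -(@eq_active _ _ u A_gt0 X)// => s' lts' act'.
  have lt_s : (s' < s)%N by apply: leq_trans lts' _; exact: leq_divnM.
  by apply: IHs => //; exact: ltn_trans lts.
rewrite /X /arm_avg /slot_avg; congr (_ / _); apply: eq_bigr => i _.
have lt_i : (slot_start K n0 s + i < slot_start K n0 s.+1)%N.
  by rewrite slot_startS ltn_add2l.
have lt_t : (slot_start K n0 s + i < t)%N.
  apply: leq_trans lt_i _; apply: leq_trans (leq_slot_start K n0_gt0 lts) _.
  by have /andP[] := slot_bounds K n0_gt0 t.
rewrite nth_history//= IH// (@slot_unique _ _ n0_gt0 s) ?leq_addr//.
by rewrite lead_active.
Qed.

End Play.
End SlotPolicy.

(** * Measurability of the actions *)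

Section Measurability.
Variables (disp : measure_display) (Omega : measurableType disp) (R : realType).

Lemma measurable_clip (f : Omega -> R) : measurable_fun setT f ->
  measurable_fun setT (fun w => clip (f w)).
Proof. by move=> mf; apply: measurable_minr => //; exact: measurable_maxr. Qed.

Variables (K : nat) (u : Omega -> R) (X : nat -> Omega -> R).
Hypotheses (K_gt0 : (0 < K)%N) (meas_u : measurable_fun setT u)
  (meas_X : forall s, measurable_fun setT (X s)).

Lemma measurable_max_est (e : nat -> Omega -> R) :
  (forall k, (k < K)%N -> measurable_fun setT (e k)) ->
  measurable_fun setT (fun w => max_est K (e^~ w)).
Proof.
rewrite /max_est; elim: K => [|n IH] me.
  exact: measurable_cst.
by apply: measurable_maxr; [apply: IH => k /ltnW/me|exact: me].
Qed.

Lemma measurable_threshold b : measurable_fun setT (fun w => threshold (u w) b).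
Proof. by apply: measurable_funM => //; exact: measurable_funM. Qed.

Lemma measurable_active_est b :
  (forall k, (k < K)%N -> measurable_fun setT (fun w => est K (u w) (X^~ w) b k))
  -> forall k, (k < K)%N ->
  measurable_fun setT (fun w => active K (u w) (X^~ w) (b * K + k)).
Proof.
move=> me k ltk; rewrite /active divn_batch// modn_batch//.
apply: measurable_fun_ler; last exact: measurable_threshold.
apply: measurable_funB; last exact: me.
exact: (@measurable_max_est (fun k w => est K (u w) (X^~ w) b k)).
Qed.

Lemma measurable_est b k : (k < K)%N ->
  measurable_fun setT (fun w => est K (u w) (X^~ w) b k).
Proof.
elim: b k => [|b IH] k ltk; first exact: measurable_cst.
under eq_fun do rewrite estS//.
by apply: measurable_fun_ifT => //; exact: measurable_active_est.
Qed.

Lemma measurable_active s :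
  measurable_fun setT (fun w => active K (u w) (X^~ w) s).
Proof.
rewrite (divn_eq s K); apply: measurable_active_est; last exact: ltn_pmod.
exact: measurable_est.
Qed.

Lemma measurable_lead s :
  measurable_fun setT (fun w => lead K (u w) (X^~ w) s).
Proof.
by elim: s => [|s IH] /=; apply: measurable_fun_ifT => //; exact: measurable_active.
Qed.

End Measurability.

Lemma slot_policy_bandit (R : realType) (d T : nat) (A : seq 'rV[R]_d) n0 :
  (0 < size A)%N -> (0 < n0)%N -> bandit_policy A T (slot_policy A n0).
Proof.
move=> A_gt0 n0_gt0; split; first by move=> h xi; exact: slot_policy_in.
move=> disp Omega xi rew t a _.
(* Several indices may carry the arm [a]; any set of natural numbers is measurable, so measurability
   of [lead] suffices. *)
rewrite (_ : [set w | _] = (fun w => lead (size A) (1 + clip (xi 0%N w))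
    (arm_avg A n0 (fun s b => rew s b w)) (slot (size A) n0 t))
    @^-1` [set k | nth 0 A k = a]); last first.
  by apply/seteqP; split => w /=; rewrite action_slot_policy.
rewrite -[X in measurable X]setTI.
apply: (@measurable_lead _ Omega R (size A) (fun w => 1 + clip (xi 0%N w))
  (fun s w => arm_avg A n0 (fun s b => rew s b w) s)) => //.
- by apply: measurable_funD => //; exact: measurable_clip.
- move=> s; apply: measurable_funM => //.
  by apply: measurable_sum => i; exact: measurable_funP.
Qed.

(** * Concentration *)

Section Independence.
Variables (disp : measure_display) (Omega : measurableType disp) (R : realType).
Variable P : probability Omega R.
Local Open Scope ereal_scope.

Import HBNNSimple.

(** The usual extension from indicators: approximate [f] from below by simple functions and apply
    monotone convergence. *)
Lemma eq_integral_indic_comp (X : {RV P >-> R}) (G G' : Omega -> R) :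
  measurable_fun setT G -> measurable_fun setT G' ->
  (forall w, 0 <= G w)%R -> (forall w, 0 <= G' w)%R ->
  (forall B, measurable B ->
     \int[P]_w (\1_B (X w) * G w)%:E = \int[P]_w (\1_B (X w) * G' w)%:E) ->
  forall f : R -> R, measurable_fun setT f -> (forall x, 0 <= f x)%R ->
  \int[P]_w (f (X w) * G w)%:E = \int[P]_w (f (X w) * G' w)%:E.
Proof.
move=> mG mG' G0 G'0 eqB f mf f0.
have mf' : measurable_fun setT (EFin \o f) by exact/measurable_EFinP.
pose h := nnsfun_approx measurableT mf'.
have mhX n : measurable_fun setT (fun w => h n (X w)).
  by apply: measurableT_comp => //; exact: measurable_funP.
have limE (H : Omega -> R) : measurable_fun setT H -> (forall w, 0 <= H w)%R ->
    \int[P]_w (f (X w) * H w)%:E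
    = limn (fun n => \sum_(y \in range (h n))
        (y%:E * \int[P]_w (\1_(h n @^-1` [set y]) (X w) * H w)%:E)).
  move=> mH H0.
  transitivity (limn (fun n => \int[P]_w (h n (X w) * H w)%:E)).
    rewrite -monotone_convergence//=.
    - apply: eq_integral => w _; apply/esym/cvg_lim => //.
      under eq_fun do rewrite EFinM.
      rewrite EFinM; apply: cvgeZr => //.
      by apply: (@cvg_nnsfun_approx _ _ _ _ _ _ mf') => // x _; rewrite lee_fin.
    - by move=> n; apply/measurable_EFinP; exact: measurable_funM.
    - by move=> n w _; rewrite lee_fin mulr_ge0.
    - move=> w _ m n mn; rewrite lee_fin ler_wpM2r//.
      exact/lefP/nd_nnsfun_approx.
  congr (limn _); apply/funext => n.
  transitivity (\int[P]_w (\sum_(y \in range (h n))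
      (y * \1_(h n @^-1` [set y]) (X w) * H w)%:E)).
    apply: eq_integral => w _; rewrite fsumEFin//; congr EFin.
    by rewrite -mulr_fsuml//; congr (_ * _)%R; rewrite -fimfunE.
  have ge0 y w : (0 <= y * \1_(h n @^-1` [set y]) (X w) * H w)%R.
    by rewrite mulr_ge0//; have := nnfun_muleindic_ge0 (h n) y (X w); rewrite lee_fin.
  have mindic y : measurable_fun setT (fun w => \1_(h n @^-1` [set y]) (X w) : R)%R.
    by apply: measurableT_comp => //; exact: measurable_indic.
  rewrite ge0_integral_fsum//; last 2 first.
  - move=> y; apply/measurable_EFinP; apply: measurable_funM => //.
    exact: measurable_funM.
  - by move=> y w _; rewrite lee_fin.
  apply: eq_fsbigr => y /[!inE] -[x _ <-].
  under eq_integral do rewrite -mulrA EFinM.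
  rewrite ge0_integralZl_EFin//.
  - by move=> w _; rewrite lee_fin mulr_ge0.
  - by apply/measurable_EFinP; exact: measurable_funM.
rewrite !limE//; congr (limn _); apply/funext => n.
apply: eq_fsbigr => y _; rewrite eqB//.
Qed.

(* The indicators are replaced one at a time by the functions [f i]. *)
Lemma integral_prod_indep (I : eqType) (X : I -> {RV P >-> R})
    (f : I -> R -> R) (m : I -> R) :
  mutual_independence X ->
  (forall i, measurable_fun setT (f i)) -> (forall i x, 0 <= f i x)%R ->
  (forall i, \int[P]_w (f i (X i w))%:E = (m i)%:E) ->
  forall (l1 l2 : seq I) (B : I -> set R),
  (forall i, measurable (B i)) -> uniq (l1 ++ l2) ->
  \int[P]_w ((\prod_(i <- l1) f i (X i w)) * \prod_(i <- l2) \1_(B i) (X i w))%:E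
  = (\prod_(i <- l1) m i)%:E * \prod_(i <- l2) P (X i @^-1` B i).
Proof.
move=> indep mf f0 Em.
have m0 i : (0 <= m i)%R.
  by rewrite -lee_fin -Em; apply: integral_ge0 => w _; rewrite lee_fin.
have mfX i : measurable_fun setT (fun w => f i (X i w)).
  by apply: measurableT_comp => //; exact: measurable_funP.
have mBX (B : I -> set R) i : (forall i, measurable (B i)) ->
    measurable_fun setT (fun w => \1_(B i) (X i w) : R)%R.
  by move=> mB; apply: measurableT_comp => //; exact: measurable_indic.
have PE A : measurable A -> P A = (fine (P A))%:E.
  by move=> mA; rewrite fineK// fin_num_measure.
elim=> [|x l1 IH] l2 B mB ul.
  rewrite big_nil mul1e -indep//.
  have mcap : measurable (\bigcap_(i in [set` l2]) (X i @^-1` B i)).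
    by apply: fin_bigcap_measurable => // i _; exact: measurable_funPTI.
  rewrite -[X in _ = P X]setIT -(integral_indic _ measurableT mcap); apply: eq_integral => w _.
  rewrite big_nil mul1r; congr EFin; rewrite indicE.
  case: (boolP (w \in _)) => [/set_mem wB|/negP wB].
    by apply: big1_seq => i /andP[_ il]; rewrite indicE mem_set//; exact: wB.
  have [i il wi] : exists2 i, i \in l2 & ~ B i (X i w).
    apply: contrapT => H; apply: wB; apply/mem_set => i il.
    by apply: contrapT => nB; apply: H; exists i.
  by rewrite (big_rem i)//= indicE memNset// mul0r.
have ul' : uniq (l1 ++ x :: l2) by rewrite -cat1s uniq_catCA.
have xl2 : x \notin l2.
  by move: ul; rewrite /= mem_cat negb_or => /andP[/andP[]].
pose p i := fine (P (X i @^-1` B i)).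
have pE : \prod_(i <- l2) P (X i @^-1` B i) = (\prod_(i <- l2) p i)%:E.
  rewrite -prodEFin; apply: eq_bigr => i _; rewrite PE//.
  exact: measurable_funPTI.
pose G w := (\prod_(i <- l1) f i (X i w) * \prod_(i <- l2) \1_(B i) (X i w))%R.
pose c := (\prod_(i <- l1) m i * \prod_(i <- l2) p i)%R.
have c0 : (0 <= c)%R.
  by rewrite mulr_ge0// prodr_ge0// => i _; exact: fine_ge0.
have mG : measurable_fun setT G.
  by apply: measurable_funM; apply: measurable_prod => i _ //; exact: mBX.
have G0 w : (0 <= G w)%R by rewrite mulr_ge0// prodr_ge0.
under eq_integral do rewrite big_cons -mulrA -/(G _).
(* To pull [f x] out, the other factors [G] are replaced by their mean [c]. It suffices to do so
   against indicators of [X x], which is the induction hypothesis with [x] moved to the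
   indicators. *)
rewrite (@eq_integral_indic_comp (X x) G (cst c))//; last first.
  move=> C mC; pose B' i := if i == x then C else B i.
  have B'E i : i \in l2 -> B' i = B i.
    by move=> il; rewrite /B'; case: eqP => // ix; rewrite -ix il in xl2.
  transitivity (\int[P]_w (\prod_(i <- l1) f i (X i w)
      * \prod_(i <- x :: l2) \1_(B' i) (X i w))%:E).
    apply: eq_integral => w _; congr EFin; rewrite big_cons /B' eqxx mulrCA.
    congr (_ * (_ * _))%R; apply: eq_big_seq => i /B'E; by rewrite /B' => ->.
  rewrite IH//; last by move=> i; rewrite /B'; case: ifP.
  rewrite big_cons {1}/B' eqxx.
  have -> : \prod_(i <- l2) P (X i @^-1` B' i) = (\prod_(i <- l2) p i)%:E.
    by rewrite -pE; apply: eq_big_seq => i /B'E ->.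
  under eq_integral do rewrite mulrC EFinM.
  rewrite ge0_integralZl_EFin//; last first.
  - by apply/measurable_EFinP; apply: measurableT_comp => //; exact: measurable_indic.
  - have -> : \int[P]_w (\1_C (X x w))%:E = \int[P]_w (\1_(X x @^-1` C) w)%:E.
      by apply: eq_integral => w _; rewrite !indicE.
    rewrite integral_indic ?setIT//; last exact: measurable_funPTI.
    by rewrite /c muleCA EFinM muleC.
under eq_integral do rewrite mulrC EFinM.
rewrite ge0_integralZl_EFin//; last exact/measurable_EFinP.
by rewrite Em big_cons pE -!EFinM /c /=; congr EFin; ring.
by move=> w _; rewrite lee_fin.
Qed.

Lemma markov_ge0 (f : Omega -> R) (A : set Omega) (t : R) :
  measurable_fun setT f -> (forall w, 0 <= f w)%R -> measurable A -> (0 <= t)%R ->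
  (forall w, A w -> t <= f w)%R -> t%:E * P A <= \int[P]_w (f w)%:E.
Proof.
move=> mf f0 mA t0 tf; rewrite -[X in _ * P X]setIT -(integral_indic P measurableT mA).
rewrite -ge0_integralZl_EFin//; last exact/measurable_EFinP/measurable_indic.
apply: ge0_le_integral => //.
- by move=> w _; rewrite -EFinM lee_fin mulr_ge0.
- by apply/measurable_EFinP; apply: measurable_funM => //; exact: measurable_indic.
- exact/measurable_EFinP.
move=> w _; rewrite -EFinM lee_fin indicE.
by case: (boolP (w \in A)) => [/set_mem/tf|_]; rewrite ?mulr1 ?mulr0.
Qed.

Lemma measurable_ltr_set (f h : Omega -> R) :
  measurable_fun setT f -> measurable_fun setT h ->
  measurable [set w | (f w < h w)%R].
Proof.
move=> mf mh; have := measurable_fun_ltr mf mh.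
by move=> /(_ measurableT [set true] I); rewrite setTI.
Qed.

Definition mgf_bounded (X : {RV P >-> R}) : Prop :=
  forall lambda : R,
    \int[P]_w (expR (lambda * X w))%:E <= (expR (lambda ^+ 2 / 2))%:E.

Lemma subgaussian_mgf (X : {RV P >-> R}) : subgaussian1 X -> mgf_bounded X.
Proof. by move=> [_ H] l; have := H l; rewrite unlock. Qed.

(** [two_runs] states subgaussianity for the first run; the second inherits it, as the moment
    generating function depends on the law alone. *)
Lemma same_law_mgf (X Y : {RV P >-> R}) :
  same_law X Y -> mgf_bounded X -> mgf_bounded Y.
Proof.
move=> XY HX l; apply: le_trans (HX l); rewrite le_eqVlt; apply/orP; left; apply/eqP.
have mexp : measurable_fun setT (fun x : R => (expR (l * x))%:E).
  apply/measurable_EFinP; apply: measurableT_comp; first exact: measurable_expR.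
  exact: measurable_funM.
have intE (Z : {RV P >-> R}) : \int[P]_w (expR (l * Z w))%:E
    = \int[distribution P Z]_x (expR (l * x))%:E.
  by rewrite ge0_integral_distribution// => x; rewrite lee_fin expR_ge0.
rewrite !intE; apply: eq_measure_integral => B mB _; exact/esym/XY.
Qed.

Lemma mutual_independence_inj (I : eqType) (J : finType) (X : I -> {RV P >-> R})
    (g : J -> I) : injective g -> mutual_independence X ->
  mutual_independence (fun j => X (g j)).
Proof.
move=> g_inj indep l B ul mB.
pose B' i := if [pick j | g j == i] is Some j then B j else setT.
have B'E j : B' (g j) = B j.
  rewrite /B'; case: pickP => [k /eqP/g_inj->//|/(_ j)]; by rewrite eqxx.
have := @indep (map g l) B'; rewrite map_inj_uniq// big_map => /(_ ul).
have mB' i : measurable (B' i) by rewrite /B'; case: pickP.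
move=> /(_ mB'); under eq_bigr do rewrite B'E.
move=> <-; congr (P _); apply/seteqP; split => w /= H i /=.
  by move=> /mapP[j jl ->]; rewrite B'E; exact: H.
by move=> il; rewrite -B'E; apply: (H (g i)); exact: map_f.
Qed.

Section Chernoff.
Variables (I : eqType) (X : I -> {RV P >-> R}) (n : nat) (g : 'I_n -> I).
Hypotheses (indep : mutual_independence X) (g_inj : injective g)
  (mgfX : forall i, mgf_bounded (X (g i))).

Lemma mgf_sum (l : R) :
  \int[P]_w (expR (l * \sum_(i < n) X (g i) w))%:E <= (expR (n%:R * (l ^+ 2 / 2)))%:E.
Proof.
pose Xg i : {RV P >-> R} := X (g i).
have indepg : mutual_independence Xg by exact: mutual_independence_inj.
have mexp : measurable_fun setT (fun x : R => expR (l * x)).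
  apply: measurableT_comp; first exact: measurable_expR.
  exact: measurable_funM.
pose m i := fine (\int[P]_w (expR (l * Xg i w))%:E).
have Em i : \int[P]_w (expR (l * Xg i w))%:E = (m i)%:E.
  rewrite /m fineK// ge0_fin_numE ?(le_lt_trans (mgfX i l)) ?ltry//.
  by apply: integral_ge0 => w _; rewrite lee_fin expR_ge0.
have := @integral_prod_indep _ Xg (fun _ x => expR (l * x)) m indepg
  (fun _ => mexp) (fun _ _ => expR_ge0 _) Em (enum 'I_n) [::] (fun=> setT) (fun=> measurableT).
rewrite cats0 => /(_ (enum_uniq _)); rewrite big_nil mule1 => E.
rewrite (eq_integral (fun w => (\prod_(i <- enum 'I_n) expR (l * Xg i w) *
    \prod_(i <- [::]) \1_(setT : set R) (Xg i w))%:E)); last first.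
  by move=> w _; rewrite big_nil mulr1 -expR_sum big_enum mulr_sumr.
rewrite E lee_fin.
apply: le_trans (_ : (\prod_(i <- enum 'I_n) expR (l ^+ 2 / 2) <= _)%R); last first.
  by rewrite big_enum/= prodr_const card_ord -expRM_natl.
apply: ler_prod => i _; rewrite -!lee_fin -Em mgfX andbT.
by apply: integral_ge0 => w _; rewrite lee_fin expR_ge0.
Qed.

(** Markov's inequality for [expR (l * S)] with the optimal [l = eps] for the upper tail and
    [l = - eps] for the lower one. *)
Lemma chernoff_sum (eps : R) : (0 < eps)%R ->
  P [set w | (n%:R * eps < `|\sum_(i < n) X (g i) w|)%R]
  <= (2 * expR (- (n%:R * (eps ^+ 2 / 2))))%:E.
Proof.
move=> e0; pose S w := (\sum_(i < n) X (g i) w)%R.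
have mS : measurable_fun setT S by apply: measurable_sum => i; exact: measurable_funP.
have tail l : (l ^+ 2 = eps ^+ 2)%R ->
    measurable [set w | (n%:R * eps ^+ 2 <= l * S w)%R] /\
    P [set w | (n%:R * eps ^+ 2 <= l * S w)%R] <= (expR (- (n%:R * (eps ^+ 2 / 2))))%:E.
  move=> l2.
  have mA : measurable [set w | (n%:R * eps ^+ 2 <= l * S w)%R].
    rewrite -[X in measurable X]setTI; apply: measurable_fun_le => //.
    exact: measurable_funM.
  split=> //.
  have := @markov_ge0 (fun w => expR (l * S w)) _ (expR (n%:R * eps ^+ 2)) _ _ mA.
  move=> /(_ _ (fun=> expR_ge0 _) (expR_ge0 _)) H.
  have {H} := le_trans (H _ _) (mgf_sum l).
  rewrite -(fineK (fin_num_measure P _ mA)) -EFinM !lee_fin l2 => H.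
  rewrite -(ler_pM2l (expR_gt0 (n%:R * eps ^+ 2))) -expRD.
  have -> : (n%:R * eps ^+ 2 + - (n%:R * (eps ^+ 2 / 2)) = n%:R * (eps ^+ 2 / 2))%R by field.
  apply: H.
    apply: measurableT_comp; first exact: measurable_expR.
    exact: measurable_funM.
  by move=> w /=; rewrite ler_expR.
have [m1 p1] := tail eps erefl.
have [m2 p2] := tail (- eps)%R (sqrrN _).
apply: (@le_trans _ _ (P ([set w | (n%:R * eps ^+ 2 <= eps * S w)%R] `|`
   [set w | (n%:R * eps ^+ 2 <= - eps * S w)%R]))).
  apply: le_measure; rewrite ?inE//.
  - by apply: measurable_ltr_set => //; exact: measurableT_comp.
  - exact: measurableU.
  move=> w /= /ltW; rewrite -/(S w) ler_normr => /orP[] H; [left|right].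
    by rewrite expr2 mulrA mulrC ler_pM2l.
  by rewrite expr2 mulrA mulrC mulNr -mulrN ler_pM2l.
apply: le_trans (measureU2 _ _ _) _ => //.
by rewrite mulrDl mul1r EFinD leeD.
Qed.
End Chernoff.

(** The law of [U] lives on [[0, 1]], where [clip] is the identity, so the event reduces to an
    interval of length [2 * c]. *)
Lemma uniform_near (U : {RV P >-> R}) (x c : R) : uniform01 U -> (0 <= c)%R ->
  P [set w | (`|1 + clip (U w) - x| <= c)%R] <= (2 * c)%:E.
Proof.
move=> UU c0; pose B := [set v : R | (`|1 + clip v - x| <= c)%R].
have mB : measurable B.
  rewrite -[X in measurable X]setTI; apply: measurable_fun_le => //.
  apply: measurableT_comp => //; apply: measurable_funB => //.
  by apply: measurable_funD => //; apply: measurable_clip.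
rewrite (_ : [set w | _] = U @^-1` B)// UU//.
rewrite /uniform_prob integral_uniform_pdf.
have sub : B `&` `[0%R, 1%R] `<=` `[(x - 1 - c)%R, (x - 1 + c)%R]%classic.
  move=> v [] /= Bv; rewrite /= !in_itv/= => v01.
  by move: Bv; rewrite /B/= clip_id// ler_norml => /andP[? ?]; apply/andP; split; lra.
have mBI : measurable (B `&` `[0%R, 1%R]%classic) by apply: measurableI.
apply: le_trans (_ : \int[lebesgue_measure]_(v in B `&` `[0%R, 1%R]) cst 1 v <= _).
  apply: ge0_le_integral => //.
  - by move=> v _; rewrite lee_fin uniform_pdf_ge0.
  - by apply/measurable_EFinP; apply: measurable_funTS; exact: measurable_uniform_pdf.
  move=> v _; rewrite lee_fin /uniform_pdf subr0 invr1; by case: ifP.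
rewrite integral_cst// mul1e.
apply: (@le_trans _ _ (lebesgue_measure `[(x - 1 - c)%R, (x - 1 + c)%R]%classic)).
  by apply: le_measure => //; rewrite inE.
rewrite lebesgue_measure_itv/= lte_fin; case: ifP => _; last by rewrite lee_fin mulr_ge0.
by rewrite -EFinB lee_fin; lra.
Qed.
End Independence.

(** A rounded binary logarithm can be found by doubling and comparing; it dominates the natural one,
    as tail bounds require. *)
Definition log_factor (M T : nat) : nat := up_log 2 (4 * M * T).

(** With accuracy [c = 1 / (8 M)], the Chernoff exponent [n0 * c ^ 2 / 2] is exactly
    [2 * log_factor M T]. *)
Definition base_len (M T : nat) : nat := (256 * log_factor M T * M ^ 2)%N.

Definition arm_factor (R : realType) (K : nat) (rho : R) : nat :=
  `|Num.ceil (K%:R / rho)|%N.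

Section Constants.
Variables (R : realType).

(** The ceiling as the least [i] with [K <= i * rho], the form in which the program finds it by
    counting up. *)
Lemma arm_factor_le (K : nat) (rho : R) i : 0 < rho ->
  (arm_factor K rho <= i)%N = (K%:R <= i%:R * rho).
Proof.
move=> rho0; rewrite -ler_pdivrMr// /arm_factor.
have c0 : 0 <= Num.ceil (K%:R / rho).
  by rewrite ceil_ge0 (lt_le_trans (ltrN10 R))// divr_ge0// ltW.
by rewrite -[i%:R]/(i%:Z%:~R) -ceil_le_int -[in RHS](gez0_abs c0).
Qed.

Lemma arm_factor_ge (K : nat) (rho : R) : 0 < rho ->
  K%:R <= (arm_factor K rho)%:R * rho.
Proof. by move=> rho0; rewrite -arm_factor_le. Qed.

Lemma arm_factor_bound (K : nat) (rho : R) : (0 < K)%N -> 0 < rho <= 1 ->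
  (arm_factor K rho)%:R <= 2 * (K%:R / rho).
Proof.
move=> K0 /andP[rho0 rho1].
have Kr1 : 1 <= K%:R / rho by rewrite ler_pdivlMr// mul1r (le_trans rho1)// ler1n.
case E: (arm_factor K rho) => [|m]; first by rewrite mulr_ge0// divr_ge0// ltW.
have : ~~ (arm_factor K rho <= m)%N by rewrite E ltnn.
rewrite arm_factor_le// -ltNge -ltr_pdivlMr// => lt_m.
by rewrite -natr1; lra.
Qed.

Lemma arm_factor_gt0 (K : nat) (rho : R) : (0 < K)%N -> 0 < rho ->
  (0 < arm_factor K rho)%N.
Proof.
move=> K0 rho0; rewrite ltnNge arm_factor_le// mul0r -ltNge ltr0n//.
Qed.

Lemma log_factor_gt0 M T : (0 < M)%N -> (0 < T)%N -> (0 < log_factor M T)%N.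
Proof. by move=> M0 T0; rewrite up_log_gt0/=; lia. Qed.

Lemma base_len_gt0 M T : (0 < M)%N -> (0 < T)%N -> (0 < base_len M T)%N.
Proof. by move=> M0 T0; rewrite !muln_gt0 log_factor_gt0//= M0. Qed.

Lemma expR_log_factor M T : (4 * M * T)%:R <= expR (log_factor M T)%:R :> R.
Proof.
apply: (@le_trans _ _ (2 ^+ log_factor M T)).
  by rewrite -natrX ler_nat; exact: up_logP.
rewrite -[(log_factor M T)%:R]mulr1 expRM_natl lerXn2r ?nnegrE ?expR_ge0//.
by apply: le_trans (expR_ge1Dx 1); lra.
Qed.

Lemma ln2_ge : 2^-1 <= ln 2 :> R.
Proof.
rewrite -[leLHS]opprK lerNl -lnV ?posrE// -(@expRK R (- 2^-1)) ler_ln ?posrE ?expR_gt0//.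
by apply: le_trans (expR_ge1Dx _); lra.
Qed.

(** Write [L] for the left side and [N = ln (K * T)]. From [2 ^ (L - 1) < 4 M T] and
    [M <= 2 K / rho] follows [2 ^ L <= 16 K T / rho]. Taking logarithms, [L / 2 <= 4 ln 2 + N + 1 /
    rho <= 7 N / rho], because [N >= ln 2 >= 1 / 2]. *)
Lemma log_factor_bound (K T : nat) (rho : R) : (0 < K)%N -> (0 < T)%N ->
  (2 <= K * T)%N -> 0 < rho <= 1 ->
  (log_factor (arm_factor K rho) T)%:R <= 14 * (ln (K * T)%:R / rho).
Proof.
move=> K0 T0 KT /andP[rho0 rho1]; set M := arm_factor _ _; set L := log_factor _ _.
have M0 : (0 < M)%N by exact: arm_factor_gt0.
have Mle : M%:R <= 2 * (K%:R / rho) :> R by apply: arm_factor_bound; rewrite ?rho0.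
have KT0 : (0 : R) < (K * T)%:R by rewrite ltr0n (leq_trans _ KT).
have r1 : 1 <= rho^-1 by rewrite invf_ge1.
have r0 : 0 < rho^-1 by rewrite invr_gt0.
have le2L : (2 : R) ^+ L <= 16 * ((K * T)%:R / rho).
  have : (2 ^ L.-1 < 4 * M * T)%N by apply: up_log_gtn => //; lia.
  have : (0 < L)%N by exact: log_factor_gt0.
  case: L => // L _ /= /ltnW; rewrite -(ler_nat R) natrX !natrM exprS => le2.
  have T0' : (0 : R) <= T%:R by [].
  have := ler_wpM2r T0' Mle; rewrite -!mulrA; move: le2; rewrite -!mulrA.
  by rewrite (mulrCA K%:R) (mulrC K%:R T%:R); lra.
have := le2L; rewrite -ler_ln ?posrE ?exprn_gt0 ?mulr_gt0//.
rewrite lnXn// lnM ?posrE ?mulr_gt0// lnM ?posrE//.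
have -> : (16 : R) = 2 ^+ 4 by ring.
rewrite lnXn//; set l2 := ln 2; have l2h : 2^-1 <= l2 := ln2_ge.
have l2N : l2 <= ln (K * T)%:R by rewrite ler_ln ?posrE// ler_nat.
set N := ln (K * T)%:R in l2N *.
have lr : ln rho^-1 <= rho^-1.
  by rewrite -[X in ln X](subrK 1) addrC (le_trans (le_ln1Dx _))//; lra.
rewrite -mulr_natr -[l2 *+ 4]mulr_natr => H.
have : L%:R * 2^-1 <= l2 * L%:R by rewrite mulrC ler_wpM2r.
have N0 : 0 <= N by lra.
have : N <= N / rho by rewrite ler_peMr.
have : rho^-1 <= 2 * (N / rho).
  by rewrite mulrA ler_peMl ?(ltW r0)//; lra.
by lra.
Qed.

End Constants.

(** * Accuracy of all averages with high probability *)

Section Noise.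
Variables (disp : measure_display) (Omega : measurableType disp) (R : realType).
Variables (P : probability Omega R) (T K M : nat) (eta : nat -> {RV P >-> R}).
Hypotheses (K_gt0 : (0 < K)%N) (M_gt0 : (0 < M)%N) (T_gt0 : (0 < T)%N).
Hypothesis indep : mutual_independence (fun t : 'I_T => eta t).
Hypothesis mgf : forall t, (t < T)%N -> mgf_bounded (eta t).

Let n0 := base_len M T.
Let n0_gt0 : (0 < n0)%N. Proof. exact: base_len_gt0. Qed.
Let c : R := 1 / (8 * M%:R).

(** The event concerns the noise at rounds fixed in advance, independently of the actions. Slots not
    completed by time [T] are left out, as the noise is controlled only before [T]. *)
Definition noisy_slot (s : nat) : set Omega :=
  [set w | (slot_start K n0 s.+1 <= T)%N /\
     (slot_len K n0 s)%:R * (c / 4 ^+ (s %/ K))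
       < `|\sum_(i < slot_len K n0 s) eta (slot_start K n0 s + i)%N w| ].

(** Slots are nonempty, so those completed by time [T] have index below [T]. *)
Definition noisy : set Omega := [set w | exists2 s, (s < T)%N & noisy_slot s w].

Lemma measurable_noisy_slot s : measurable (noisy_slot s).
Proof.
have [le|nle] := boolP (slot_start K n0 s.+1 <= T)%N; last first.
  rewrite (_ : noisy_slot s = set0)//.
  by apply/seteqP; split=> w // [] /=; rewrite (negPf nle).
rewrite (_ : noisy_slot s = [set w | (slot_len K n0 s)%:R * (c / 4 ^+ (s %/ K))
       < `|\sum_(i < slot_len K n0 s) eta (slot_start K n0 s + i)%N w| ]); last first.
  by apply/seteqP; split=> w; [case|split].
apply: measurable_ltr_set => //; apply: measurableT_comp => //.
by apply: measurable_sum => i; exact: measurable_funP.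
Qed.

Lemma noisy_slot_prob s :
  (P (noisy_slot s) <= (1 / (8 * M%:R ^+ 2 * T%:R ^+ 2))%:E)%E.
Proof.
have [le|nle] := boolP (slot_start K n0 s.+1 <= T)%N; last first.
  rewrite (_ : noisy_slot s = set0) ?measure0 ?lee_fin ?divr_ge0 ?mulr_ge0//.
  by apply/seteqP; split=> w // [] /=; rewrite (negPf nle).
have lt_T (i : 'I_(slot_len K n0 s)) : (slot_start K n0 s + i < T)%N.
  by apply: leq_trans le; rewrite slot_startS ltn_add2l.
pose g i := Ordinal (lt_T i).
have g_inj : injective g by move=> i j /(congr1 val)/= /addnI/val_inj.
have := @chernoff_sum _ _ _ _ _ _ _ g indep g_inj (fun i => mgf (lt_T i)) (c / 4 ^+ (s %/ K)).
have M0 : 0 < M%:R :> R by rewrite ltr0n.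
have T0 : 0 < T%:R :> R by rewrite ltr0n.
move=> /(_ _)/le_trans; set Q := P _; move=> H.
have -> : noisy_slot s = [set w | (slot_len K n0 s)%:R * (c / 4 ^+ (s %/ K))
       < `|\sum_(i < slot_len K n0 s) eta (slot_start K n0 s + i)%N w| ].
  by apply/seteqP; split=> w; [case|split].
apply: H; first by rewrite divr_gt0 ?exprn_gt0// divr_gt0// mulr_gt0.
rewrite lee_fin.
(* The growth [16 ^ b] cancels the square of [4 ^ b], so every batch has exponent [2 L], and
   [2 exp (- 2 L) <= 2 / (4 M T) ^ 2]. *)
have -> : (slot_len K n0 s)%:R * ((c / 4 ^+ (s %/ K)) ^+ 2 / 2)
    = (log_factor M T)%:R + (log_factor M T)%:R.
  rewrite /slot_len /n0 /base_len !natrM !natrX (_ : 16 = 4 ^+ 2 :> R); last by ring.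
  rewrite -exprM mulnC exprM /c; field.
  by rewrite expf_neq0// gt_eqF.
rewrite expRN expRD.
have := @expR_log_factor R M T; rewrite !natrM => H.
have H0 : 0 < 4 * M%:R * T%:R :> R by rewrite !mulr_gt0.
rewrite -[leLHS]/(2 / _) ler_pdivrMr ?mulr_gt0 ?expR_gt0//.
rewrite mul1r ler_pdivlMl ?mulr_gt0 ?exprn_gt0//.
apply: le_trans (ler_pM (ltW H0) (ltW H0) H H).
by rewrite le_eqVlt; apply/orP; left; apply/eqP; ring.
Qed.

Lemma union_bound (F : nat -> set Omega) (n : nat) (x : R) :
  (forall i, (i < n)%N -> measurable (F i)) ->
  (forall i, (i < n)%N -> (P (F i) <= x%:E)%E) ->
  measurable [set w | exists2 i, (i < n)%N & F i w] /\
  (P [set w | exists2 i, (i < n)%N & F i w] <= (n%:R * x)%:E)%E.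
Proof.
elim: n => [|n IH] mF PF.
  rewrite (_ : [set w | _] = set0) ?measure0 ?mul0r//.
  by apply/seteqP; split=> w // [].
have [m p] := IH (fun i lt => mF i (ltnW lt)) (fun i lt => PF i (ltnW lt)).
rewrite (_ : [set w | _] = [set w | exists2 i, (i < n)%N & F i w] `|` F n).
  split; first by apply: measurableU => //; exact: mF.
  apply: le_trans (measureU2 _ m (mF _ (ltnSn _))) _.
  by rewrite -natr1 mulrDl mul1r EFinD leeD// PF.
apply/seteqP; split=> w /=.
  by move=> [i]; rewrite ltnS leq_eqVlt => /predU1P[->|lt Fi]; [right|left; exists i].
by move=> [[i lt Fi]|Fn]; [exists i => //; exact: ltnW|exists n].
Qed.

Lemma measurable_noisy : measurable noisy.
Proof.
by have [] := @union_bound noisy_slot T _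
  (fun i _ => measurable_noisy_slot i) (fun i _ => noisy_slot_prob i).
Qed.

Lemma noisy_prob : (P noisy <= (1 / (8 * M%:R ^+ 2 * T%:R))%:E)%E.
Proof.
have [_ /le_trans] := @union_bound noisy_slot T _
  (fun i _ => measurable_noisy_slot i) (fun i _ => noisy_slot_prob i).
apply; rewrite lee_fin le_eqVlt; apply/orP; left; apply/eqP; field.
by rewrite !pnatr_eq0 -!lt0n M_gt0 T_gt0.
Qed.

(** The error of an average is the averaged noise. Slots in batches before that of round [t] are
    complete by then, hence covered by [noisy]. *)
Lemma accurate_arm_avg (d : nat) (A : seq 'rV[R]_d) (theta : 'rV[R]_d) w t :
  size A = K -> (t < T)%N -> ~ noisy w ->
  accurate K (fun k => dotp theta (nth 0 A k)) c
    (arm_avg A n0 (linear_reward theta (fun s => eta s w))) (slot K n0 t %/ K).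
Proof.
move=> sA lt_t nw s lts; rewrite /arm_avg /slot_avg sA.
have lts' : (s < slot K n0 t)%N by apply: leq_trans lts (leq_divnM _ _).
have /andP[le_t _] := slot_bounds K n0_gt0 t.
have le1 : (slot_start K n0 s.+1 <= T)%N.
  apply: leq_trans (ltnW lt_t); apply: leq_trans le_t.
  exact: leq_slot_start.
have lt_s : (s < T)%N.
  apply: leq_ltn_trans (leq_slot_start_id K n0_gt0 s) _.
  exact: leq_trans (slot_start_ltS K n0_gt0 s) le1.
have l0 : 0 < (slot_len K n0 s)%:R :> R by rewrite ltr0n slot_len_gt0.
rewrite /linear_reward big_split /= sumr_const card_ord -[_ *+ _]mulr_natr.
rewrite mulrDl mulfK ?gt_eqF// addrAC subrr add0r normrM normfV (gtr0_norm l0).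
rewrite ler_pdivrMr// mulrC leNgt; apply/negP => lt.
by apply: nw; exists s.
Qed.

End Noise.

(** * Replicability and regret *)

(** Expanding the squared norms of [u + v] and [u - v] gives twice the absolute inner product at
    most the sum of the squared norms. *)
Lemma dotp_le1 (R : realType) (d : nat) (u v : 'rV[R]_d) :
  l2norm u <= 1 -> l2norm v <= 1 -> `|dotp u v| <= 1.
Proof.
have dot_le1 (x : 'rV[R]_d) : l2norm x <= 1 -> dotp x x <= 1.
  move=> x1; have x0 : 0 <= dotp x x by apply: sumr_ge0 => i _; rewrite -expr2 sqr_ge0.
  by rewrite -(sqr_sqrtr x0) expr_le1// sqrtr_ge0.
move=> /dot_le1 u1 /dot_le1 v1.
have : 0 <= dotp u u + dotp v v + 2 * dotp u v.
  rewrite /dotp mulr_sumr -!big_split/=; apply: sumr_ge0 => i _.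
  by have := sqr_ge0 (u 0 i + v 0 i); rewrite sqrrD -!expr2 -mulr_natl; lra.
have : 0 <= dotp u u + dotp v v - 2 * dotp u v.
  rewrite /dotp mulr_sumr -sumrN -!big_split/=; apply: sumr_ge0 => i _.
  by have := sqr_ge0 (u 0 i - v 0 i); rewrite sqrrB -!expr2 -mulr_natl; lra.
by rewrite ler_norml; lra.
Qed.

(** The increment satisfies [1 / sqrt (n + 1) <= 2 (sqrt (n + 1) - sqrt n)], which amounts to
    [0 <= (sqrt (n + 1) - sqrt n) ^ 2]. *)
Lemma sum_inv_sqrt (R : realType) (n : nat) :
  \sum_(t < n) (Num.sqrt t.+1%:R)^-1 <= 2 * Num.sqrt n%:R :> R.
Proof.
elim: n => [|n IH]; first by rewrite big_ord0 mulr_ge0// sqrtr_ge0.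
rewrite big_ord_recr/=; apply: le_trans (lerD IH (lexx _)) _.
have b0 : 0 < Num.sqrt n.+1%:R :> R by rewrite sqrtr_gt0.
rewrite -(ler_pM2r b0) mulrDl mulVf ?gt_eqF//.
have := sqr_ge0 (Num.sqrt n.+1%:R - Num.sqrt n%:R : R).
have a2 : Num.sqrt n%:R ^+ 2 = n%:R :> R by rewrite sqr_sqrtr.
have b2 : Num.sqrt n.+1%:R ^+ 2 = n%:R + 1 :> R by rewrite sqr_sqrtr// natr1.
by rewrite sqrrB a2 -!mulrA -expr2 b2 -mulr_natl; lra.
Qed.

Section Analysis.
Variables (R : realType) (d T : nat) (A : seq 'rV[R]_d) (rho : R).
Let K := size A.
Let M := arm_factor K rho.
Let n0 := base_len M T.
Hypotheses (T_gt0 : (0 < T)%N) (rho01 : 0 < rho <= 1) (K_gt0 : (0 < K)%N).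
Hypothesis (normA : forall a, a \in A -> l2norm a <= 1).

Let rho_gt0 : 0 < rho. Proof. by case/andP: rho01. Qed.
Let M_gt0 : (0 < M)%N. Proof. exact: arm_factor_gt0. Qed.
Let n0_gt0 : (0 < n0)%N. Proof. exact: base_len_gt0. Qed.
Let c : R := 1 / (8 * M%:R).
Let Mr_gt0 : 0 < M%:R :> R. Proof. by rewrite ltr0n. Qed.
Let c_gt0 : 0 < c. Proof. by rewrite divr_gt0// mulr_gt0. Qed.
Let c_le : c <= 1 / 8.
Proof. by rewrite ler_pM2l// lef_pV2 ?posrE ?mulr_gt0// ler_peMr// ler1n. Qed.

Let KM : K%:R / M%:R <= rho.
Proof. by rewrite ler_pdivrMr// mulrC arm_factor_ge. Qed.

Let M_rho : 1 / M%:R <= rho.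
Proof. by apply: le_trans KM; rewrite ler_pM2r ?invr_gt0// ler1n. Qed.

Section Theta.
Variables (theta : 'rV[R]_d).
Hypothesis (norm_theta : l2norm theta <= 1).

Let mu k := dotp theta (nth 0 A k).

Let mu_le1 k : (k < K)%N -> `|mu k| <= 1.
Proof. by move=> ltk; apply: dotp_le1 => //; apply/normA/mem_nth. Qed.

Let exists_best : exists2 best, (best < K)%N &
  forall k, (k < K)%N -> mu k <= mu best.
Proof.
have [i _ Hi] := @Order.TotalTheory.arg_maxP _ R _ (Ordinal K_gt0) xpredT
  (fun k : 'I_K => mu k) isT.
by exists i => // k ltk; exact: (Hi (Ordinal ltk)).
Qed.

Let u01 (x : R) : (1 <= 1 + clip x) * (1 + clip x <= 2).
Proof. by case/andP: (clip_itv x). Qed.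

Section Runs.
Variables (disp : measure_display) (Omega : measurableType disp).
Variables (P : probability Omega R) (xi : nat -> {RV P >-> R}).

Let act (eta : nat -> {RV P >-> R}) w t :=
  action (slot_policy A n0) (fun j => xi j w)
    (linear_reward theta (fun s => eta s w)) t.

Let leadw (eta : nat -> {RV P >-> R}) w t :=
  lead K (1 + clip (xi 0%N w))
    (arm_avg A n0 (linear_reward theta (fun s => eta s w))) (slot K n0 t).

Let actE eta w t : act eta w t = nth 0 A (leadw eta w t).
Proof. exact: action_slot_policy. Qed.

Let measurable_leadw eta t : measurable_fun setT (fun w => leadw eta w t).
Proof.
apply: (@measurable_lead _ Omega R K (fun w => 1 + clip (xi 0%N w))
  (fun s w => arm_avg A n0 (linear_reward theta (fun i => eta i w)) s)) => //.
- by apply: measurable_funD => //; exact: measurable_clip.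
- move=> s; apply: measurable_funM => //.
  by apply: measurable_sum => i; apply: measurable_funD => //; exact: measurable_funP.
Qed.

(** Each run is noisy with probability at most [rho / 8], and [1 + U] is within [2 * c] of the
    center of some arm with probability at most [K * 4 c = K / (2 M) <= rho / 2]. Otherwise
    [eq_lead_separated] applies. *)
Lemma slot_policy_agreement (eta1 eta2 : nat -> {RV P >-> R}) :
  uniq A ->
  uniform01 (xi 0%N) ->
  mutual_independence (fun t : 'I_T => eta1 t) ->
  mutual_independence (fun t : 'I_T => eta2 t) ->
  (forall t, (t < T)%N -> mgf_bounded (eta1 t)) ->
  (forall t, (t < T)%N -> mgf_bounded (eta2 t)) ->
  ((1 - rho)%:E <= P [set w | [seq act eta1 w t | t <- iota 0 T]
                            = [seq act eta2 w t | t <- iota 0 T]])%E.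
Proof.
move=> uA U01 ind1 ind2 mgf1 mgf2; have [best best_lt best_max] := exists_best.
have /choice[x Hx] : forall k, exists x : R, (k < K)%N -> forall v b, 1 <= v <= 2 ->
    `|v - (mu best - mu k) * 4 ^+ b| <= 2 * c -> `|v - x| <= 2 * c.
  move=> k; case: (ltnP k K) => ltk; last by exists 0.
  by have [x Hx] := separation_center c_le best_max ltk; exists x.
pose near k := [set w | `|1 + clip (xi 0%N w) - x k| <= 2 * c].
have mnear k : measurable (near k).
  rewrite -[X in measurable X]setTI; apply: measurable_fun_le => //.
  apply: measurableT_comp => //; apply: measurable_funB => //.
  by apply: measurable_funD => //; apply: measurable_clip.
have c2 : 0 <= 2 * c by rewrite mulr_ge0// ltW.
have [mN pN] := @union_bound _ _ _ P near K _ (fun k _ => mnear k)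
  (fun k _ => uniform_near (x k) U01 c2).
set N := [set w | _] in mN pN.
set B1 := noisy T K M eta1; set B2 := noisy T K M eta2.
have mB1 : measurable B1 by exact: measurable_noisy.
have mB2 : measurable B2 by exact: measurable_noisy.
have pB1 : (P B1 <= _)%E := noisy_prob K M_gt0 T_gt0 ind1 mgf1.
have pB2 : (P B2 <= _)%E := noisy_prob K M_gt0 T_gt0 ind2 mgf2.
set E := [set w | _].
have mE : measurable E.
  (* As [A] has no duplicates, equality of arms is equality of indices, which are measurable
     functions. *)
  rewrite (_ : E = \bigcap_(t in [set` iota 0 T])
      [set w | leadw eta1 w t = leadw eta2 w t]).
    apply: fin_bigcap_measurable => // t _.
    rewrite (_ : [set w | _] = (fun w => leadw eta1 w t == leadw eta2 w t) @^-1` [set true]).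
      rewrite -[X in measurable X]setTI.
      exact: (measurable_fun_eqn (@measurable_leadw eta1 t) (@measurable_leadw eta2 t)).
    by apply/seteqP; split=> w /= /eqP.
  apply/seteqP; split=> w /=.
    move=> /eq_in_map H t /H; rewrite !actE => /eqP.
    by rewrite nth_uniq ?lead_lt// => /eqP.
  by move=> H; apply/eq_in_map => t /H/=; rewrite !actE => ->.
have sub : ~` (B1 `|` B2 `|` N) `<=` E.
  move=> w /= nBN; apply/eq_in_map => t; rewrite mem_iota add0n => /andP[_ lt_t].
  rewrite !actE; congr nth.
  have acc (eta : nat -> {RV P >-> R}) : ~ noisy T K M eta w -> accurate K mu c
      (arm_avg A n0 (linear_reward theta (fun s => eta s w))) (slot K n0 t %/ K).
    by move=> nw s; exact: accurate_arm_avg.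
  have acc1 := acc eta1 (fun h => nBN (or_introl (or_introl h))).
  have acc2 := acc eta2 (fun h => nBN (or_introl (or_intror h))).
  apply: (eq_lead_separated K_gt0 _ _ c_gt0 c_le mu_le1 best_lt best_max
    _ acc1 acc2); rewrite ?u01//.
  move=> b k ltk; rewrite ltNge; apply/negP => le_c; apply: nBN; right.
  by exists k => //; apply: Hx le_c => //; rewrite !u01.
have mBN : measurable (B1 `|` B2 `|` N) by apply: measurableU => //; exact: measurableU.
apply: le_trans (_ : P (~` (B1 `|` B2 `|` N)) <= _)%E; last first.
  by apply: le_measure; rewrite ?inE//; exact: measurableC.
rewrite probability_setC// EFinB leeB//.
apply: le_trans (measureU2 _ _ mN) _; first exact: measurableU.
apply: le_trans (leeD (measureU2 _ mB1 mB2) pN) _.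
apply: le_trans (leeD (leeD pB1 pB2) (lexx _)) _.
rewrite -!EFinD lee_fin /c.
have -> : K%:R * (2 * (2 * (1 / (8 * M%:R)))) = K%:R / M%:R / 2 :> R.
  by field; rewrite gt_eqF.
have : 1 / (8 * M%:R ^+ 2 * T%:R) <= 1 / M%:R / 8 :> R.
  rewrite !mul1r -invfM lef_pV2 ?posrE ?mulr_gt0 ?exprn_gt0 ?ltr0n//.
  rewrite -!natrX -!natrM ler_nat; apply: leq_trans (leq_pmulr _ T_gt0).
  by rewrite mulnC leq_mul2l -[leqLHS]expn1 leq_pexp2l.
by move: KM M_rho rho_gt0; lra.
Qed.

(** Off the noisy event, round [t] costs at most [36 r / sqrt (t + 1)] with [r = sqrt (2 K n0)], in
    total [72 r sqrt T]. The noisy event adds at most [2 T / (8 M ^ 2 T) <= 1 <= r sqrt T], whence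
    73. *)
Lemma slot_policy_regret (eta : nat -> {RV P >-> R}) :
  mutual_independence (fun t : 'I_T => eta t) ->
  (forall t, (t < T)%N -> mgf_bounded (eta t)) ->
  (expected_regret T A theta (slot_policy A n0) xi eta
     <= (73 * Num.sqrt (2 * (K * n0 * T))%:R)%:E)%E.
Proof.
move=> ind mgf; have [best best_lt best_max] := exists_best.
have supE : sup [set dotp theta a | a in [set` A]] = mu best.
  have memb : [set dotp theta a | a in [set` A]] (mu best).
    by exists (nth 0 A best) => //; exact: mem_nth.
  have ub : ubound [set dotp theta a | a in [set` A]] (mu best).
    move=> _ [a /= aA <-]; rewrite -(nth_index 0 aA); apply: best_max.
    by rewrite index_mem.
  apply/eqP; rewrite eq_le ge_sup//=; last by exists (mu best).
  by apply: ub_le_sup => //; exists (mu best).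
rewrite /expected_regret supE.
pose Z w := \sum_(t < T) dotp theta (act eta w t).
rewrite -[X in (_ - 'E_P[X])%E]/Z.
have ZE w : Z w = \sum_(t < T) mu (leadw eta w t).
  by apply: eq_bigr => t _; rewrite actE.
have mZ : measurable_fun setT Z.
  rewrite (_ : Z = fun w => \sum_(t < T) mu (leadw eta w t)); last exact/funext.
  apply: measurable_sum => t.
  by apply: (measurableT_comp _ (@measurable_leadw eta t)).
have gap0 w t : 0 <= mu best - mu (leadw eta w t).
  by rewrite subr_ge0 best_max// lead_lt.
have gap2 w t : mu best - mu (leadw eta w t) <= 2.
  have := mu_le1 best_lt; have : `|mu (leadw eta w t)| <= 1 by rewrite mu_le1// lead_lt.
  by rewrite !ler_norml; lra.
have gapE w : T%:R * mu best - Z w = \sum_(t < T) (mu best - mu (leadw eta w t)).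
  by rewrite sumrB sumr_const card_ord -[mu best *+ T]mulr_natl ZE.
have intZ : Z \in Lfun P 1.
  apply/Lfun1_integrable; apply: measurable_bounded_integrable => //.
    by apply: le_lt_trans (probability_le1 P measurableT) _; rewrite ltry.
  exists T%:R; split; first exact: num_real.
  move=> x ltx w _ /=; rewrite ZE; apply: le_trans (ler_norm_sum _ _ _) _.
  apply: le_trans (ltW ltx); rewrite -[leRHS]mulr1 -[T in leRHS]card_ord mulr_natl -sumr_const.
  by apply: ler_sum => t _; rewrite mu_le1// lead_lt.
have -> : ((T%:R * mu best)%R%:E - 'E_P[Z])%E = ('E_P[(cst (T%:R * mu best) \- Z)%R])%E.
  by rewrite expectationB ?expectation_cst//; exact: Lfun_cst.
set B := noisy T K M eta.
have mB : measurable B by exact: measurable_noisy.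
have pB : (P B <= _)%E := noisy_prob K M_gt0 T_gt0 ind mgf.
have T0 : 0 < T%:R :> R by rewrite ltr0n.
pose r : R := Num.sqrt (2 * (K * n0))%:R.
have r0 : 0 <= r by exact: sqrtr_ge0.
pose Y w : R := 72 * (r * Num.sqrt T%:R) + 2 * T%:R * \1_B w.
have Y0 w : 0 <= Y w by rewrite addr_ge0 ?mulr_ge0 ?sqrtr_ge0// indicE.
have mY : measurable_fun setT Y.
  by apply: measurable_funD => //; apply: measurable_funM => //; exact: measurable_indic.
have XY w : T%:R * mu best - Z w <= Y w.
  rewrite gapE /Y indicE; case: (boolP (w \in B)) => [_|/negP nB].
    rewrite mulr1; apply: le_trans (_ : \sum_(t < T) 2 <= _).
      by apply: ler_sum => t _; exact: gap2.
    rewrite sumr_const card_ord -[2 *+ T]mulr_natr lerDr.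
    by rewrite !mulr_ge0 ?sqrtr_ge0.
  rewrite mulr0 addr0.
  apply: le_trans (_ : \sum_(t < T) 36 * r * (Num.sqrt t.+1%:R)^-1 <= _).
    apply: ler_sum => t _.
    have acc : accurate K mu c
      (arm_avg A n0 (linear_reward theta (fun s => eta s w))) (slot K n0 t %/ K).
      by move=> s; apply: accurate_arm_avg => // h; apply: nB; rewrite inE.
    apply: le_trans (lead_gap K_gt0 _ _ c_gt0 c_le mu_le1 best_lt best_max acc) _;
      rewrite ?u01//.
    rewrite -mulrA ler_pM2l//.
    have t0 : 0 < Num.sqrt t.+1%:R :> R by rewrite sqrtr_gt0.
    rewrite ler_pdivlMr// ler_pdivrMl ?exprn_gt0//.
    have -> : 4 ^+ (slot K n0 t %/ K) = Num.sqrt (16 ^ (slot K n0 t %/ K))%:R :> R.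
      by rewrite (_ : 16 = 4 ^ 2)%N// -expnM mulnC expnM natrX sqrtr_sqr ger0_norm// natrX.
    rewrite -sqrtrM// ler_sqrt// -natrM ler_nat.
    by rewrite mulnC -mulnA; exact: leq_slot_time.
  rewrite -mulr_sumr; have := ler_wpM2l (mulr_ge0 (ler0n R 36) r0) (sum_inv_sqrt R T).
  lra.
apply: le_trans (expectation_le _ mY _ Y0 _) _.
- exact: measurable_funB.
- by move=> w; rewrite /= gapE sumr_ge0.
- by apply: aeW => w; exact: XY.
have -> : ('E_P[Y] = (72 * (r * Num.sqrt T%:R))%R%:E + (2 * T%:R)%R%:E * P B)%E.
  rewrite unlock /Y; under eq_integral do rewrite EFinD.
  rewrite ge0_integralD//; last 2 first.
  - by move=> w _; rewrite lee_fin !mulr_ge0 ?sqrtr_ge0.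
  - by apply/measurable_EFinP; apply: measurable_funM => //; exact: measurable_indic.
  congr (_ + _)%E.
    by have := expectation_cst P (72 * (r * Num.sqrt T%:R)); rewrite unlock.
  under eq_integral do rewrite EFinM.
  rewrite ge0_integralZl_EFin//; first by rewrite integral_indic// setIT.
  by apply/measurable_EFinP; exact: measurable_indic.
apply: le_trans (leeD (lexx _) (lee_pmul _ _ (lexx _) pB)) _ => //.
rewrite -EFinM -EFinD lee_fin mulnA natrM sqrtrM// -/r.
have : 2 * T%:R * (1 / (8 * M%:R ^+ 2 * T%:R)) <= 1 :> R.
  have -> : 2 * T%:R * (1 / (8 * M%:R ^+ 2 * T%:R)) = (4 * M%:R ^+ 2)^-1 :> R.
    by field; rewrite !gt_eqF.
  by rewrite invf_le1 ?mulr_gt0 ?exprn_gt0// -natrX -natrM ler1n muln_gt0 expn_gt0 M_gt0.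
have : 1 <= r * Num.sqrt T%:R.
  rewrite /r -sqrtrM// -natrM -[leLHS]sqrtr1 ler_sqrt// ler1n.
  by rewrite muln_gt0 T_gt0 andbT muln_gt0 /= muln_gt0 K_gt0.
by lra.
Qed.

End Runs.
End Theta.
End Analysis.

(** * The program *)

Section Steps.
Variables (R : realType) (d : nat) (A : seq 'rV[R]_d) (xi : nat -> R).
Variable rew : nat -> 'rV[R]_d -> R.
Implicit Types (c : cmd) (s : state R d) (Q : state R d -> Prop).

(** An executable semantics of loop-free commands, so that straight-line code is verified by
    computation; loops are left to [while_exec]. *)
Fixpoint step c s : option (state R d) :=
  let: State m cl k h := s in
  match c with
  | Skip => Some s
  | Seq c1 c2 => obind (step c2) (step c1 s)
  | SetI x e => Some (State (set_int m x (ieval m e)) cl k h)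
  | SetR x i j e =>
      Some (State m (set_cell cl x (ieval m i) (ieval m j) (reval m cl e)) k h)
  | If b c1 c2 => if beval m cl b then step c1 s else step c2 s
  | While _ _ => None
  | Draw x i j =>
      Some (State m (set_cell cl x (ieval m i) (ieval m j) (xi k)) k.+1 h)
  | Pull e x i j =>
      if (ieval m e < size A)%N then
        let a := nth 0 A (ieval m e) in
        let r := rew (size h) a in
        Some (State m (set_cell cl x (ieval m i) (ieval m j) r) k (rcons h (a, r)))
      else None
  end.

Fixpoint max_cost c : nat :=
  match c with
  | Skip => 1
  | Seq c1 c2 => max_cost c1 + max_cost c2
  | SetI x e => (icost e).+1
  | SetR x i j e => (icost i + icost j + rcost e).+1
  | If b c1 c2 => (bcost b + maxn (max_cost c1) (max_cost c2)).+1
  | While _ _ => 0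
  | Draw x i j => (icost i + icost j).+1
  | Pull e x i j => (icost e + icost i + icost j).+1
  end.

Lemma step_exec c s s' : step c s = Some s' ->
  exists2 n, exec A xi rew c s s' n & (n <= max_cost c)%N.
Proof.
elim: c s s' => [|c1 IH1 c2 IH2|x e|x i j e|b c1 IH1 c2 IH2|b c1 _|x i j|e x i j] s s'.
- by case: s => m cl k h [<-]; exists 1%N => //; exact: ExecSkip.
- case: s => m cl k h /=; case E1: step => [s1|//] /= E2.
  have [n1 X1 l1] := IH1 _ _ E1; have [n2 X2 l2] := IH2 _ _ E2.
  by exists (n1 + n2)%N; [exact: ExecSeq X1 X2|exact: leq_add].
- by case: s => m cl k h [<-]; exists (icost e).+1 => //; exact: ExecSetI.
- by case: s => m cl k h [<-]; eexists; [exact: ExecSetR|exact: leqnn].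
- case: s => m cl k h /= E.
  have [n X l] : exists2 n, exec A xi rew (if beval m cl b then c1 else c2)
      (State m cl k h) s' n & (n <= maxn (max_cost c1) (max_cost c2))%N.
    case: ifP E => _ E; [have [n ? l] := IH1 _ _ E|have [n ? l] := IH2 _ _ E];
    by exists n => //; rewrite leq_max l ?orbT.
  by exists (bcost b + n).+1; [exact: ExecIf|rewrite ltnS leq_add2l].
- by case: s.
- by case: s => m cl k h [<-]; eexists; [exact: ExecDraw|exact: leqnn].
- case: s => m cl k h /=; case: ifP => // lt [<-].
  by eexists; [exact: ExecPull|exact: leqnn].
Qed.

Definition ensures c Q s : Prop := exists2 s', step c s = Some s' & Q s'.

Lemma ensures_seq c1 c2 Q s :
  ensures c1 (ensures c2 Q) s -> ensures (Seq c1 c2) Q s.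
Proof.
by case: s => m cl k h [s1 E1 [s2 E2 q]]; exists s2 => //=; rewrite E1.
Qed.

Lemma ensures_if b c1 c2 Q s :
  ensures (if beval (ints s) (cells s) b then c1 else c2) Q s ->
  ensures (If b c1 c2) Q s.
Proof. by case: s => m cl k h; rewrite /ensures /=; case: ifP. Qed.

(** A loop rule for a known number [N] of iterations: indexing the invariant by the iterations done
    yields termination and cost as well. *)
Lemma while_exec b c (I : nat -> state R d -> Prop) N :
  (forall i s, (i < N)%N -> I i s ->
     beval (ints s) (cells s) b /\ ensures c (I i.+1) s) ->
  (forall s, I N s -> ~~ beval (ints s) (cells s) b) ->
  forall s, I 0%N s -> exists s' n, [/\ exec A xi rew (While b c) s s' n, I N s' &
    (n <= N.+1 * (bcost b + max_cost c).+1)%N].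
Proof.
move=> Ib Iend.
suff H i s : (i <= N)%N -> I (N - i)%N s ->
    exists s' n, [/\ exec A xi rew (While b c) s s' n, I N s' &
    (n <= i.+1 * (bcost b + max_cost c).+1)%N].
  by move=> s I0; apply: H => //; rewrite subnn.
elim: i s => [|i IH] s lei Is.
  rewrite subn0 in Is; exists s, (bcost b).+1; split=> //.
    by apply: ExecWhileFalse; exact: Iend.
  by rewrite mul1n ltnS leq_addr.
have [|bt [s1 E1 I1]] := Ib (N - i.+1)%N s _ Is; first by lia.
have [n1 X1 l1] := step_exec E1.
rewrite subnSK// in I1; have [s2 [n2 [X2 I2 l2]]] := IH _ (ltnW lei) I1.
exists s2, (bcost b + n1 + n2).+1; split=> //; first exact: ExecWhileTrue bt X1 X2.
by rewrite mulSn -addSn leq_add// ltnS leq_add2l.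
Qed.

End Steps.

Definition scalar (x : nat) : rexpr := RCell x (ICst 0) (ICst 0).

Definition set_scalar (x : nat) (e : rexpr) : cmd := SetR x (ICst 0) (ICst 0) e.

Definition rnat (n : nat) : rexpr := ROfInt (ICst n).

(* Integer variables: 1, 2 hold K, T; 3 the number of rounds played; 4 the arm
   of the current slot; 5 the last active arm.  Scalar cells: 0 holds rho;
   2 the random number; 4 arm_factor; 5 a power of 2; 6 its exponent; 7 the
   length of the slot; 8 the threshold; 9 the maximal estimate of the previous
   batch; 10 the running maximum of this batch; 11 the number of rounds and 12
   the sum of the rewards in the slot; 13 the last reward.  The array 3 holds
   the estimates. *)
Definition arm_factor_loop : cmd :=
  While (BNot (BLeR (ROfInt (IVar 1)) (RMul (scalar 4) (scalar 0))))
    (set_scalar 4 (RAdd (scalar 4) (rnat 1))).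

Definition log_factor_loop : cmd :=
  While (BNot (BLeR (RMul (RMul (rnat 4) (scalar 4)) (ROfInt (IVar 2))) (scalar 5)))
    (Seq (set_scalar 5 (RAdd (scalar 5) (scalar 5)))
         (set_scalar 6 (RAdd (scalar 6) (rnat 1)))).

Definition arm_est : rexpr := RCell 3 (IVar 4) (ICst 0).

Definition minus10 : rexpr := RSub (rnat 0) (rnat 10).

Definition is_active : bexpr := BLeR (RSub (scalar 9) arm_est) (scalar 8).

Definition play_round : cmd :=
  Seq (If is_active (SetI 5 (IVar 4)) Skip)
  (Seq (Pull (IVar 5) 13 (ICst 0) (ICst 0))
  (Seq (set_scalar 12 (RAdd (scalar 12) (scalar 13)))
  (Seq (set_scalar 11 (RAdd (scalar 11) (rnat 1)))
       (SetI 3 (IAdd (IVar 3) (ICst 1)))))).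

Definition end_batch : cmd :=
  Seq (SetI 4 (ICst 0))
  (Seq (set_scalar 9 (scalar 10))
  (Seq (set_scalar 10 minus10)
  (Seq (set_scalar 7 (RMul (rnat 16) (scalar 7)))
       (set_scalar 8 (RDiv (scalar 8) (rnat 4)))))).

Definition end_slot : cmd :=
  Seq (If is_active (SetR 3 (IVar 4) (ICst 0) (RDiv (scalar 12) (scalar 7)))
         (SetR 3 (IVar 4) (ICst 0) minus10))
  (Seq (If (BLeR (scalar 10) arm_est) (set_scalar 10 arm_est) Skip)
  (Seq (set_scalar 12 (rnat 0))
  (Seq (set_scalar 11 (rnat 0))
  (Seq (SetI 4 (IAdd (IVar 4) (ICst 1)))
       (If (BLeI (IVar 1) (IVar 4)) end_batch Skip))))).

Definition round_body : cmd :=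
  Seq play_round (If (BLeR (scalar 7) (scalar 11)) end_slot Skip).

Definition main_loop : cmd :=
  While (BNot (BLeI (IVar 2) (IVar 3))) round_body.

Definition init_slots : cmd :=
  Seq (set_scalar 7
    (RMul (RMul (rnat 256) (scalar 6)) (RMul (scalar 4) (scalar 4))))
  (Seq (set_scalar 8 (RMul (rnat 4) (RAdd (rnat 1) (scalar 2))))
       (set_scalar 10 minus10)).

Definition bandit_prog : cmd :=
  Seq (Draw 2 (ICst 0) (ICst 0))
  (Seq arm_factor_loop
  (Seq (set_scalar 5 (rnat 1))
  (Seq log_factor_loop
  (Seq init_slots main_loop)))).

(** * Invariants and running time of the program *)

Section Correctness.
Variables (R : realType) (d T : nat) (A : seq 'rV[R]_d) (rho : R).
Let K := size A.
Let M := arm_factor K rho.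
Let n0 := base_len M T.
Hypotheses (T_gt0 : (0 < T)%N) (K_gt0 : (0 < K)%N) (rho01 : 0 < rho <= 1).
Variables (xi : nat -> R) (rew : nat -> 'rV[R]_d -> R).
Hypothesis xi01 : forall j, 0 <= xi j <= 1.

Let rho_gt0 : 0 < rho. Proof. by case/andP: rho01. Qed.
Let M_gt0 : (0 < M)%N. Proof. exact: arm_factor_gt0. Qed.
Let n0_gt0 : (0 < n0)%N. Proof. exact: base_len_gt0. Qed.

Let u := 1 + clip (xi 0%N).
Let X := arm_avg A n0 rew.
Let pol := slot_policy A n0.
Let rr i := rew i (action pol xi rew i).

(** Here [j] of the [t] rounds played belong to slot [s]. The array 3 is overwritten during a batch:
    arms already passed hold new estimates, the others old ones. Hence the old maximum is kept in a
    separate cell. *)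
Definition slot_state (t s j : nat) (st : state R d) : Prop :=
  [/\ ints st 1 = K, ints st 2 = T, ints st 3 = t & ints st 4 = (s %% K)%N] /\
  [/\ cells st 7 0 0 = (slot_len K n0 s)%:R,
      cells st 8 0 0 = threshold u (s %/ K),
      cells st 9 0 0 = max_est K (est K u X (s %/ K)),
      cells st 10 0 0 = running_max (est K u X (s %/ K).+1) (s %% K) &
      forall k, (k < K)%N -> cells st 3 k 0 =
        est K u X (if (k < s %% K)%N then (s %/ K).+1 else s %/ K)%N k] /\
  [/\ cells st 11 0 0 = j%:R,
      cells st 12 0 0 = \sum_(i < j) rr (slot_start K n0 s + i)%N &
      played st = history pol xi rew t].

(** On entering a slot with an active arm, variable 5 is still out of date, but [play_round] sets it
    before pulling. *)
Definition before_round (t : nat) (st : state R d) : Prop :=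
  slot_state t (slot K n0 t) (t - slot_start K n0 (slot K n0 t))%N st /\
  (active K u X (slot K n0 t) \/ ints st 5 = lead K u X (slot K n0 t)).

Definition after_pull (t : nat) (st : state R d) : Prop :=
  slot_state t.+1 (slot K n0 t) (t.+1 - slot_start K n0 (slot K n0 t))%N st.

Lemma play_round_ok t st : before_round t st ->
  ensures A xi rew play_round
    (fun st' => after_pull t st' /\ ints st' 5 = lead K u X (slot K n0 t)) st.
Proof.
case: st => m cl k h [[[/= m1 m2 m3 m4] [[c7 c8 c9 c10 c3] [c11 c12 Eh]]] /= act5].
set s := slot K n0 t in m4 c7 c8 c9 c10 c3 c11 c12 act5 *.
have /andP[le_t _] : (slot_start K n0 s <= t < slot_start K n0 s.+1)%N :=
  slot_bounds K n0_gt0 t.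
have actE : cl 9 0 0 - cl 3 (m 4) 0 <= cl 8 0 0 = active K u X s.
  by rewrite c9 m4 c3 ?ltn_pmod// ltnn c8.
have aE : action pol xi rew t = nth 0 A (lead K u X s) by exact: action_slot_policy.
have rrE : rew (size h) (nth 0 A (lead K u X s)) = rr t.
  by rewrite Eh size_history /rr aE.
have sumE : \sum_(i < t.+1 - slot_start K n0 s) rr (slot_start K n0 s + i)%N
    = \sum_(i < t - slot_start K n0 s) rr (slot_start K n0 s + i)%N + rr t.
  by rewrite subSn// big_ord_recr/= subnKC.
have hE : history pol xi rew t.+1
    = rcons h (nth 0 A (lead K u X s), rew (size h) (nth 0 A (lead K u X s))).
  by rewrite Eh size_history /= -aE.
pose m' := if active K u X s then set_int m 5 (m 4) else m.
have m'5 : m' 5 = lead K u X s.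
  rewrite /m'; case: ifP act5 => [act _|_ [//|//]].
  by rewrite /set_int/= lead_active.
have m'E x : x != 5%N -> m' x = m x.
  by rewrite /m' => nx; case: ifP => // _; rewrite /set_int (negPf nx).
rewrite /ensures /=; rewrite actE.
have -> : (if active K u X s then Some (State (set_int m 5 (m 4)) cl k h)
    else Some (State m cl k h)) = Some (State m' cl k h) by rewrite /m'; case: ifP.
rewrite /= m'5 lead_lt//; eexists; first by [].
split; last by rewrite /= /set_int/= m'5.
split; first by split; rewrite /= /set_int/= ?m'E// m3 addn1.
split; first by split.
split; last exact: esym hE.
  by rewrite /= /set_cell/= c11 subSn// natr1.
by rewrite /= /set_cell/= c12 sumE rrE.
Qed.


Lemma round_end_ok t st : after_pull t st -> ints st 5 = lead K u X (slot K n0 t) ->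
  ensures A xi rew (If (BLeR (scalar 7) (scalar 11)) end_slot Skip)
    (before_round t.+1) st.
Proof.
set s := slot K n0 t.
case: st => m cl k0 h [[/= m1 m2 m3 m4] [[c7 c8 c9 c10 c3] [c11 c12 Eh]]] /= m5.
rewrite -/s in m4 c7 c8 c9 c10 c3 c11 c12.
have /andP[le_t lt_t] : (slot_start K n0 s <= t < slot_start K n0 s.+1)%N :=
  slot_bounds K n0_gt0 t.
have slotS : slot K n0 t.+1 = if (slot_start K n0 s.+1 <= t.+1)%N then s.+1 else s by [].
apply: ensures_if; rewrite [beval _ _ _]/= c7 c11 ler_nat.
rewrite leq_subRL ?(leq_trans le_t)// -slot_startS.
rewrite /before_round slotS; case: ifP => [end_s|_]; last first.
  by eexists; first by []; split; [|right].
have {lt_t end_s} Et : t.+1 = slot_start K n0 s.+1 by apply/eqP; rewrite eqn_leq lt_t.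
rewrite Et subnn.
pose b := (s %/ K)%N; pose k := (s %% K)%N; rewrite -/b -/k in c8 c9 c10 c3 m4.
have ltk : (k < K)%N by exact: ltn_pmod.
pose e := est K u X b.+1.
have Es : s = (b * K + k)%N by exact: divn_eq.
have ek : e k = if active K u X s then X s else - 10 by rewrite /e estS// -Es.
have actE : cl 9 0 0 - cl 3 (m 4) 0 <= cl 8 0 0 = active K u X s.
  by rewrite c9 m4 c3// ltnn c8.
have avgE : active K u X s -> cl 12 0 0 / cl 7 0 0 = X s.
  move=> act; rewrite c12 c7 /X /arm_avg /slot_avg Et slot_startS addKn.
  congr (_ / _); apply: eq_bigr => i _; rewrite /rr action_slot_policy//.
  rewrite (@slot_unique _ _ n0_gt0 s); first by rewrite lead_active.
  by rewrite slot_startS leq_addr ltn_add2l /=.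
pose cl1 := set_cell cl 3 (m 4) 0 (e k).
pose cl2 := if cl1 10 0 0 <= cl1 3 (m 4) 0 then set_cell cl1 10 0 0 (cl1 3 (m 4) 0) else cl1.
have step1 : (if active K u X s
    then Some (State m (set_cell cl 3 (m 4) 0 (cl 12 0 0 / cl 7 0 0)) k0 h)
    else Some (State m (set_cell cl 3 (m 4) 0 (0%:R - 10)) k0 h)) = Some (State m cl1 k0 h).
  by rewrite /cl1 ek sub0r; case: ifP => // /avgE->.
have cl1k : cl1 3 (m 4) 0 = e k by rewrite /cl1 /set_cell/= eqxx.
have cl1_10 : cl1 10 0 0 = running_max e k by rewrite /cl1 /set_cell/= c10.
have cl2_10 : cl2 10 0 0 = running_max e k.+1.
  by rewrite /cl2 cl1k cl1_10 /=; case: leP => _; rewrite ?cl1_10.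
have cl2E x i : x != 10%N -> cl2 x i 0 = cl1 x i 0.
  by move=> nx; rewrite /cl2; case: ifP => // _; rewrite /set_cell (negPf nx).
have cl2_3 i : (i < K)%N -> cl2 3 i 0 = est K u X (if (i < k.+1)%N then b.+1 else b) i.
  move=> lti; rewrite cl2E// /cl1 /set_cell/= m4 andbT.
  by have [->|ne] := eqVneq i k; rewrite ?ltnSn// c3// ltnS [(i <= k)%N]leq_eqVlt (negPf ne).
have cl2E' x : x \notin [:: 3; 10]%N -> cl2 x 0 0 = cl x 0 0.
  rewrite !inE negb_or => /andP[n3 n10].
  by rewrite cl2E// /cl1 /set_cell (negPf n3).
apply: ensures_seq; exists (State m cl1 k0 h); first by rewrite /= actE.
apply: ensures_seq; exists (State m cl2 k0 h); first by rewrite /= /cl2; case: ifP.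
rewrite /ensures /= {1 2}/set_int/= m1 m4 addn1.
(* If the next slot is inactive, [lead] does not change and variable 5 stays correct. The last
   disjunct is refuted at [x = m]. *)
have lead_ok x : active K u X s.+1 \/
    ints (State x cl2 k0 h) 5 = lead K u X s.+1 \/ x 5%N <> m 5%N.
  rewrite /=; case: ifP; [by left|move=> _; right].
  by have [->|/eqP] := eqVneq (x 5%N) (m 5%N); [left|right].
have [[Ek [Eb Ek']]|[lt [Eb Ek']]] := divn_modnS K_gt0 s.
  have -> : (K <= k.+1)%N by rewrite /k Ek prednK.
  rewrite /=; eexists; first by [].
  split; last first.
    by case: (lead_ok m) => [|[]]; [left|right|].
  rewrite /slot_state Eb Ek' /=.
  split; first by split; rewrite /set_int/= ?m3// Et.
  split; last by split=> //; rewrite ?big_ord0// -Et.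
  split; rewrite /set_cell/=.
  - by rewrite cl2E'// c7 /slot_len Eb expnS mulnCA [RHS]natrM.
  - by rewrite cl2E'// c8 /threshold exprS invfM [4^-1 * _]mulrC mulrA.
  - by rewrite cl2_10 /max_est /k Ek prednK.
  - by rewrite sub0r.
  - by move=> i lti; rewrite cl2_3// /k Ek prednK// lti.
have -> : (K <= k.+1)%N = false by rewrite leqNgt lt.
rewrite /=; eexists; first by [].
split; last first.
  by case: (lead_ok m) => [|[]]; [left|right|].
rewrite /slot_state Eb Ek' /=.
split; first by split; rewrite /set_int/= ?m3// Et.
split; last by split=> //; rewrite ?big_ord0// -Et.
split; rewrite /set_cell/=.
- by rewrite cl2E'// c7 /slot_len Eb.
- by rewrite cl2E'.
- by rewrite cl2E'.
- exact: cl2_10.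
- exact: cl2_3.
Qed.


Lemma max_est0 : max_est K (fun _ => 0 : R) = 0.
Proof.
apply/eqP; rewrite eq_le (@ge_max_est _ _ (fun=> 0) 0%N)// andbT.
apply: (@running_max_le _ (fun=> 0) 0 K) => //; exact: ltW.
Qed.

Definition ready (st : state R d) : Prop :=
  [/\ ints st 1 = K, ints st 2 = T, ints st 3 = 0%N & ints st 4 = 0%N] /\
  [/\ cells st 0 0 0 = rho, cells st 2 0 0 = xi 0%N & forall k, cells st 3 k 0 = 0] /\
  [/\ cells st 9 0 0 = 0, cells st 11 0 0 = 0, cells st 12 0 0 = 0 & played st = [::]].

Lemma arm_factor_loop_ok st : ready st -> cells st 4 0 0 = 0 ->
  cells st 6 0 0 = 0 ->
  exists st' n, [/\ exec A xi rew arm_factor_loop st st' n,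
    ready st' /\ cells st' 4 0 0 = M%:R /\ cells st' 6 0 0 = 0 &
    (n <= M.+1 * 30)%N].
Proof.
move=> rst c4 c6.
pose I i st := ready st /\ cells st 4 0 0 = i%:R /\ cells st 6 0 0 = 0.
have Ib i s : (i < M)%N -> I i s ->
    beval (ints s) (cells s) (BNot (BLeR (ROfInt (IVar 1)) (RMul (scalar 4) (scalar 0))))
    /\ ensures A xi rew (set_scalar 4 (RAdd (scalar 4) (rnat 1))) (I i.+1) s.
  case: s => m cl k h lti [[[/= m1 m2 m3 m4] [[c0 c2 c3] [c9 c11 c12 Eh]]] [/= E4 E6]].
  rewrite /= m1 E4 c0 -arm_factor_le// -ltnNge lti; split=> //.
  by eexists; first by []; split=> //; split; rewrite /= /set_cell//= E4 natr1.
have Ie s : I M s ->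
    ~~ beval (ints s) (cells s) (BNot (BLeR (ROfInt (IVar 1)) (RMul (scalar 4) (scalar 0)))).
  case: s => m cl k h [[[/= m1 _ _ _] [[c0 _ _] _]] [/= E4 _]].
  by rewrite /= m1 E4 c0 -arm_factor_le// leqnn.
have [|s' [n [X' I' n']]] := while_exec Ib Ie (s := st); first by [].
by exists s', n; split=> //; apply: leq_trans n' _; rewrite leq_mul2l.
Qed.

Lemma log_factor_loop_ok st : ready st -> cells st 4 0 0 = M%:R ->
  cells st 5 0 0 = 1 -> cells st 6 0 0 = 0 ->
  exists st' n, [/\ exec A xi rew log_factor_loop st st' n,
    ready st' /\ cells st' 4 0 0 = M%:R /\ cells st' 6 0 0 = (log_factor M T)%:R &
    (n <= (log_factor M T).+1 * 40)%N].
Proof.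
move=> rst c4 c5 c6.
pose I i st := ready st /\ cells st 4 0 0 = M%:R /\ cells st 5 0 0 = 2 ^+ i /\
  cells st 6 0 0 = i%:R.
pose test := BNot (BLeR (RMul (RMul (rnat 4) (scalar 4)) (ROfInt (IVar 2))) (scalar 5)).
pose body := Seq (set_scalar 5 (RAdd (scalar 5) (scalar 5)))
  (set_scalar 6 (RAdd (scalar 6) (rnat 1))).
have Ib i s : (i < log_factor M T)%N -> I i s ->
    beval (ints s) (cells s) test /\ ensures A xi rew body (I i.+1) s.
  case: s => m cl k h lti [[[/= m1 m2 m3 m4] [[c0 c2 c3] [c9 c11 c12 Eh]]] [/= E4 [E5 E6]]].
  rewrite /= m2 E4 E5 -natrX -!natrM ler_nat; split.
    by apply/negP => /(@up_log_min 2 _ _ isT); rewrite leqNgt lti.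
  eexists; first by []; split=> //; split=> //.
  by split; rewrite /= /set_cell//= ?E5 ?E6 ?natr1// exprS mulr2n mulrDl !mul1r.
have Ie s : I (log_factor M T) s -> ~~ beval (ints s) (cells s) test.
  case: s => m cl k h [[[/= _ m2 _ _] _] [/= E4 [E5 _]]].
  by rewrite /= m2 E4 E5 -natrX -!natrM ler_nat negbK; exact: up_logP.
have [|s' [n [X' [r' [c4' [_ c6']]] n']]] := while_exec Ib Ie (s := st); first by [].
by exists s', n; split=> //; apply: leq_trans n' _; rewrite leq_mul2l.
Qed.

Lemma init_slots_ok st : ready st -> cells st 4 0 0 = M%:R ->
  cells st 6 0 0 = (log_factor M T)%:R ->
  ensures A xi rew init_slots (before_round 0) st.
Proof.
case: st => m cl k h [[/= m1 m2 m3 m4] [[c0 c2 c3] [c9 c11 c12 Eh]]] E4 E6.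
eexists; first by [].
have start0 : slot_start K n0 0 = 0%N by rewrite /slot_start big_ord0.
split; last first.
  left; apply: active0; rewrite ?div0n// ltW// /u.
  by case/andP: (clip_itv (xi 0%N)) => *; lra.
rewrite /slot_state div0n mod0n start0 subn0; split; first by split.
split; split; rewrite /= /set_cell//= ?big_ord0 ?max_est0 ?sub0r//.
- by rewrite E4 E6 /slot_len div0n expn0 muln1 /n0 /base_len !natrM !mulrA.
- by rewrite c2 /threshold expr0 divr1 /u clip_id.
Qed.

Lemma main_loop_ok st : before_round 0 st ->
  exists st' n, [/\ exec A xi rew main_loop st st' n,
    played st' = history pol xi rew T & (n <= T.+1 * 200)%N].
Proof.
move=> b0.
have Ib t s : (t < T)%N -> before_round t s ->
    beval (ints s) (cells s) (BNot (BLeI (IVar 2) (IVar 3)))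
    /\ ensures A xi rew round_body (before_round t.+1) s.
  move=> ltt br; split.
    by case: s br => m cl k h [[[/= m1 m2 m3 m4] _] _]; rewrite /= m2 m3 -ltnNge.
  apply: ensures_seq; have [s1 E1 [a1 l1]] := play_round_ok br.
  by exists s1 => //; exact: round_end_ok.
have Ie s : before_round T s ->
    ~~ beval (ints s) (cells s) (BNot (BLeI (IVar 2) (IVar 3))).
  by case: s => m cl k h [[[/= m1 m2 m3 m4] _] _]; rewrite /= m2 m3 leqnn.
have [s' [n [X' [[_ [_ [_ _ h']]] _] n']]] := while_exec Ib Ie b0.
by exists s', n; split=> //; apply: leq_trans n' _; rewrite leq_mul2l.
Qed.

Lemma bandit_prog_ok : exists s n,
  [/\ exec A xi rew bandit_prog (init_state T A rho) s n,
      played s = history pol xi rew T & (n <= 1000 * (M * T))%N].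
Proof.
pose st0 : state R d := State (ints (init_state T A rho))
  (set_cell (cells (init_state T A rho)) 2 0 0 (xi 0%N)) 1 [::].
have X0 : exec A xi rew (Draw 2 (ICst 0) (ICst 0)) (init_state T A rho) st0 3.
  exact: ExecDraw.
have r0 : ready st0 by [].
have [[m cl k h] [n1 [X1 [r1 [c4 c6]] l1]]] := arm_factor_loop_ok r0 erefl erefl.
pose st2 : state R d := State m (set_cell cl 5 0 0 1%:R) k h.
have X2 : exec A xi rew (set_scalar 5 (rnat 1)) (State m cl k h) st2 5.
  exact: ExecSetR.
have r2 : ready st2 by [].
have [s3 [n3 [X3 [r3 [c4' c6']] l3]]] := log_factor_loop_ok r2 c4 erefl c6.
have [s4 E4 b4] := init_slots_ok r3 c4' c6'.
have [n4 X4 l4] := step_exec E4.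
have [s5 [n5 [X5 h5 l5]]] := main_loop_ok b4.
exists s5, (3 + (n1 + (5 + (n3 + (n4 + n5)))))%N; split=> //.
  by do 4![apply: ExecSeq; first by eassumption]; apply: ExecSeq X4 X5.
(* By [n < 2 ^ n], at most [4 M T] doublings occur, so every loop takes [O(M T)] operations. *)
have lL : (log_factor M T <= 4 * M * T)%N.
  by apply: up_log_min => //; exact/ltnW/ltn_expl.
have lM : (M <= M * T)%N by rewrite leq_pmulr.
have lT : (T <= M * T)%N by rewrite leq_pmull.
rewrite -mulnA in lL; move: l4; rewrite [max_cost _]/=.
by move: (M * T)%N lL lM lT => N; lia.
Qed.

End Correctness.

(** * The theorem *)

(** The variables 1, 2, 3 stand for [K], [T], [1 / rho]; 2000 comes from [1000 M T] operations and
    [M <= 2 K / rho]. *)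
Definition time_bound (R : realType) : mpoly.mpoly 4 R :=
  let var i : mpoly.mpoly 4 R := mpoly.mpolyX R (mpoly.mnm1 (inord i)) in
  2000 *: (var 1%N * var 2%N * var 3%N).

Lemma time_boundE (R : realType) (d K T : nat) (rho : R) :
  mpoly.meval (fun i : 'I_4 => nth 0 [:: d%:R; K%:R; T%:R; rho^-1] i) (time_bound R)
  = 2000 * (K%:R * T%:R / rho).
Proof.
by rewrite mpoly.mevalZ !mpoly.mevalM !mpoly.mevalXU !inordK.
Qed.

Section PolicyBounds.
Variables (R : realType) (d T : nat) (A : seq 'rV[R]_d) (rho : R).
Let K := size A.
Let M := arm_factor K rho.
Let n0 := base_len M T.
Hypotheses (T_gt0 : (0 < T)%N) (K_gt0 : (0 < K)%N) (d_gt0 : (0 < d)%N).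
Hypothesis (rho01 : 0 < rho <= 1).

Let rho_gt0 : 0 < rho. Proof. by case/andP: rho01. Qed.
Let M_gt0 : (0 < M)%N. Proof. exact: arm_factor_gt0. Qed.
Let n0_gt0 : (0 < n0)%N. Proof. exact: base_len_gt0. Qed.
Let M_le : M%:R <= 2 * (K%:R / rho). Proof. exact: arm_factor_bound. Qed.

Lemma slot_policy_implemented :
  implements_within bandit_prog T A rho (slot_policy A n0)
    (2000 * (K%:R * T%:R / rho)).
Proof.
move=> xi rew xi01; have [s [n [X h l]]] := bandit_prog_ok T_gt0 K_gt0 rho01 rew xi01.
exists s, n; split=> //; apply: (@le_trans _ _ (1000 * (M * T))%:R).
  by rewrite ler_nat.
rewrite !natrM; have := ler_wpM2r (ler0n R T) M_le.
by rewrite -!mulrA [rho^-1 * _]mulrC; lra.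
Qed.

(** With [L <= 14 N / rho] and [M <= 2 K / rho], the radicand [512 K T L M ^ 2] is at most
    [28672 K ^ 3 T N / rho ^ 3]. As [28672 <= 170 ^ 2] and [d K / rho >= 1], the constant
    [73 * 170 = 12410] works. *)
Lemma regret_scale : (2 <= K * T)%N ->
  73 * Num.sqrt (2 * (K * n0 * T))%:R
  <= 12410 * (K%:R ^+ 2 / rho ^+ 2) * Num.sqrt (d%:R * T%:R * ln (K * T)%:R) :> R.
Proof.
move=> KT; have Lle : (log_factor M T)%:R <= 14 * (ln (K * T)%:R / rho).
  exact: log_factor_bound.
set N : R := ln (K * T)%:R in Lle *.
have N0 : 0 <= N by rewrite ln_ge0// ler1n ltnW.
have q0 : 0 <= K%:R ^+ 2 / rho ^+ 2 by rewrite divr_ge0 ?exprn_ge0// ltW.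
set S := Num.sqrt (d%:R * _ * _).
rewrite (_ : 12410 * _ * S = 73 * (170 * (K%:R ^+ 2 / rho ^+ 2) * S)); last by ring.
rewrite ler_pM2l// /S.
have -> : 170 * (K%:R ^+ 2 / rho ^+ 2) = Num.sqrt ((170 * (K%:R ^+ 2 / rho ^+ 2)) ^+ 2) :> R.
  by rewrite sqrtr_sqr ger0_norm// mulr_ge0.
rewrite -sqrtrM ?sqr_ge0//.
apply: ler_wsqrtr.
rewrite /n0 /base_len !natrM.
set k : R := K%:R; set t : R := T%:R; set m : R := M%:R; set l : R := (log_factor M T)%:R.
have k1 : 1 <= k by rewrite ler1n.
have t0 : 0 <= t by exact: ler0n.
have k0 : 0 <= k by exact: ler0n.
have d1 : 1 <= d%:R :> R by rewrite ler1n.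
pose q := rho^-1; have q1 : 1 <= q by rewrite invf_ge1//; case/andP: rho01.
have m2 : m ^+ 2 <= 4 * (k * q) ^+ 2.
  rewrite (_ : 4 * _ = (2 * (k * q)) ^+ 2); last by ring.
  apply: lerXn2r; last exact: M_le; first by rewrite nnegrE.
  by rewrite nnegrE !mulr_ge0// (le_trans ler01).
have lm : l * m ^+ 2 <= 14 * (N * q) * (4 * (k * q) ^+ 2).
  by rewrite ler_pM ?sqr_ge0.
have e1 : 512 * (k * t) * (l * m ^+ 2)
    <= 512 * (k * t) * (14 * (N * q) * (4 * (k * q) ^+ 2)).
  exact: ler_wpM2l (mulr_ge0 (ler0n R 512) (mulr_ge0 k0 t0)) _ _ lm.
have q0' : 0 <= q by exact: le_trans q1.
have P0 : 0 <= k ^+ 3 * q ^+ 3 * t * N.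
  exact: mulr_ge0 (mulr_ge0 (mulr_ge0 (exprn_ge0 3 k0) (exprn_ge0 3 q0')) t0) N0.
have e2 : k ^+ 3 * q ^+ 3 * t * N <= (k ^+ 3 * q ^+ 3 * t * N) * (k * q * d%:R).
  exact: ler_peMr P0 (mulr_ege1 (mulr_ege1 k1 q1) d1).
have -> : (170 * (k ^+ 2 / rho ^+ 2)) ^+ 2 * (d%:R * t * N)
    = 170 * 170 * ((k ^+ 3 * q ^+ 3 * t * N) * (k * q * d%:R)).
  by rewrite -exprVn -/q; ring.
apply: le_trans (_ : 512 * (14 * 4) * (k ^+ 3 * q ^+ 3 * t * N) <= _); last first.
  have c0 : 0 <= 512 * (14 * 4) :> R by lra.
  have c1 : 512 * (14 * 4) <= 170 * 170 :> R by lra.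
  exact: ler_pM c0 P0 c1 e2.
rewrite (_ : 2 * _ = 512 * (k * t) * (l * m ^+ 2)); last by ring.
by apply: le_trans e1 _; rewrite le_eqVlt; apply/orP; left; apply/eqP; ring.
Qed.

(** For [K = T = 1] the logarithm in the claimed bound is 0, so a single arm calls for the exact
    value of the regret. *)
Lemma single_arm_regret (disp : measure_display) (Omega : measurableType disp)
    (P : probability Omega R) (theta : 'rV[R]_d) (xi eta : nat -> {RV P >-> R}) :
  K = 1%N -> expected_regret T A theta (slot_policy A n0) xi eta = 0%E.
Proof.
move=> K1; have [a EA] : exists a, A = [:: a].
  by move: K1; rewrite /K; case: (A) => [//|a [|//]] _; exists a.
have acta x r t : action (slot_policy A n0) x r t = a.
  suff : action (slot_policy A n0) x r t \in A.
    by rewrite [X in _ \in X]EA inE => /eqP.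
  exact: slot_policy_in.
rewrite /expected_regret.
have -> : [set dotp theta b | b in [set` A]] = [set dotp theta a].
  apply/seteqP; split=> x /=.
    by move=> [b + <-]; rewrite EA inE => /eqP->.
  by move=> ->; exists a; rewrite // EA inE.
rewrite sup1.
have -> : (fun w => \sum_(t < T) dotp theta (action (slot_policy A n0) (fun j => xi j w)
   (linear_reward theta (fun s => eta s w)) t)) = cst (T%:R * dotp theta a).
  apply/funext => w /=; under eq_bigr do rewrite acta.
  by rewrite sumr_const card_ord mulr_natl.
by rewrite expectation_cst subee.
Qed.

End PolicyBounds.

Theorem theorem6 (R : realType) :
  exists (C : R)
    (alg : forall d : nat, nat -> seq 'rV[R]_d -> R -> policy R d)
    (prog : cmd) (p : mpoly.mpoly 4 R),
    0 < C /\
    forall (T : nat) (rho : R) (d K : nat) (A : seq 'rV[R]_d),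
      (1 <= T)%N -> 0 < rho <= 1 -> (1 <= d)%N -> (1 <= K)%N ->
      uniq A -> size A = K -> (forall a, a \in A -> l2norm a <= 1) ->
      let pol := alg d T A rho in
      [/\ bandit_policy A T pol,
          replicable T rho pol,
          (forall (disp : measure_display) (Omega : measurableType disp)
             (P : probability Omega R) (theta : 'rV[R]_d)
             (xi eta : nat -> {RV P >-> R}),
             l2norm theta <= 1 -> one_run T xi eta ->
             (expected_regret T A theta pol xi eta <=
              (C * (K%:R ^+ 2 / rho ^+ 2)
                 * Num.sqrt (d%:R * T%:R * ln ((K * T)%:R)))%:E)%E) &
          implements_within prog T A rho pol
            (mpoly.meval
               (fun i : 'I_4 => nth 0 [:: d%:R; K%:R; T%:R; rho^-1] i) p)].
Proof.
have [C C_gt0 CE] : exists2 C : R, 0 < C & C = 12410.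
  by exists 12410; rewrite ?ltr0n.
exists C, (fun d T (A : seq 'rV[R]_d) rho =>
    slot_policy A (base_len (arm_factor (size A) rho) T)),
  bandit_prog, (time_bound R).
split=> // T rho d K A T1 rho01 d1 K1 uA sA normA pol; subst K.
have M_gt0 : (0 < arm_factor (size A) rho)%N.
  by apply: arm_factor_gt0 => //; case/andP: rho01.
split.
- by apply: slot_policy_bandit => //; exact: base_len_gt0.
- move=> disp Omega P theta xi eta1 eta2 ntheta [U01 sub1 same12 indep].
  apply: slot_policy_agreement => //.
  + by apply: (mutual_independence_inj (g := fun t => inr (inl t)) _ indep) => t t' [].
  + by apply: (mutual_independence_inj (g := fun t => inr (inr t)) _ indep) => t t' [].
  + by move=> t /sub1/subgaussian_mgf.
  + by move=> t lt; apply: same_law_mgf (same12 _ lt) _; exact/subgaussian_mgf/sub1.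
- move=> disp Omega P theta xi eta ntheta [U01 sub indep].
  have [K2|K1'] := leqP 2 (size A); last first.
    rewrite single_arm_regret//; last by apply/eqP; rewrite eqn_leq K1 -ltnS K1'.
    rewrite lee_fin !mulr_ge0 ?sqrtr_ge0 ?invr_ge0 ?exprn_ge0 ?(ltW C_gt0)//.
    by apply: ltW; case/andP: rho01.
  apply: le_trans (_ : (73 * Num.sqrt (2 * (size A *
      base_len (arm_factor (size A) rho) T * T))%:R)%:E <= _)%E.
    apply: slot_policy_regret => //.
    + by apply: (mutual_independence_inj (g := fun t => inr t) _ indep) => t t' [].
    + by move=> t /sub/subgaussian_mgf.
  by rewrite lee_fin CE; apply: regret_scale => //; rewrite (leq_trans K2)// leq_pmulr.
- by rewrite time_boundE; exact: slot_policy_implemented.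
Qed.
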